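(* Let $(a_n)_{n\ge 1}$ be a sequence of complex numbers with $\lim_{n\to\infty} n^{1/2}|a_n| = 0$, and let $(\varepsilon_n)_{n\ge 1}$ be chosen independently and uniformly at random from $\{\pm 1\}$. Then almost surely there exists $z\in\mathbb{C}$ with $|z|=1$ such that the series $\sum_{n=1}^{\infty}\varepsilon_n a_n z^{n}$ converges.
   Context: Convergence of the series means convergence of its sequence of partial sums. The sequence $(a_n)$ is deterministic. *)

(* Defs.v *)
From HB Require Import structures.
From mathcomp Require Import all_boot all_order all_algebra.
From mathcomp Require Import finmap.
From mathcomp Require Import all_classical all_reals all_analysis.
From mathcomp Require Import complex.

Set Implicit Arguments.
Unset Strict Implicit.
Unset Printing Implicit Defensive.

Import Order.TTheory GRing.Theory Num.Theory.
Import numFieldNormedType.Exports.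

Local Open Scope classical_set_scope.
Local Open Scope ring_scope.

(* The norm topology carried by every abstract numFieldType is not inferred on
   the concrete type R[i]; this instance is convertible to it. *)
HB.instance Definition _ (R : realType) := NormedModule.copy R[i] R[i]^o.

Section Independence.
Context d d' (T : measurableType d) (U : measurableType d') (R : realType).
Context (P : probability T R).

Definition mutually_independent (I : choiceType) (D : set I)
    (X : I -> {RV P >-> U}) : Prop :=
  forall (J : {fset I}) (B : I -> set U),
    [set` J] `<=` D -> (forall i, measurable (B i)) ->
    P (\bigcap_(i in [set` J]) (X i @^-1` B i)) =
    (\prod_(i <- J) P (X i @^-1` B i))%E.

End Independence.

(* The two probabilities sum to 1, so X = 1 or X = -1 almost surely. *)
Definition uniform_sign d (T : measurableType d) (R : realType)
    (P : probability T R) (X : {RV P >-> R}) : Prop :=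
  P (X @^-1` [set 1]) = (2^-1)%:E /\ P (X @^-1` [set -1]) = (2^-1)%:E.

(* Main.v *)
Require Import Defs.
From HB Require Import structures.
From mathcomp Require Import all_boot all_order all_algebra.
From mathcomp Require Import finmap.
From mathcomp Require Import all_classical all_reals all_analysis.
From mathcomp Require Import complex.
From mathcomp Require Import ring lra zify.

Set Implicit Arguments.
Unset Strict Implicit.
Unset Printing Implicit Defensive.

Import Order.TTheory GRing.Theory Num.Theory.
Import numFieldNormedType.Exports.

Local Open Scope classical_set_scope.
Local Open Scope ring_scope.
Local Open Scope complex_scope.

(** Only the case where the energies [sum |a_n|^2] diverge is serious.  When
they are summable, Kolmogorov's maximal inequality shows that the series is
almost surely Cauchy already at [z = 1].

In the divergent case a convergence point is found by a branching search over
finer and finer grids of the circle.  Put [delta_j] for a slowly decreasing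
majorant of [sqrt n |a_n|] and cut the indices into blocks [N_j <= n < N_(j+1)],
where [N_(j+1)] is a large multiple of [N_j] and the block has energy
comparable to [delta_j^2].  Level [j] lives on the grid of [q_j = A N_j]
equally spaced angles; a sum over [n < N_j] hardly varies between neighbouring
angles of that grid.  An angle of level [j+1] is kept alive when its parent is
alive, the partial sum up to [N_(j+1)] is at most [r_(j+1)], and all partial
sums inside the block are [O(delta_j)].  Here [r] decreases by a constant times
[delta_j] at each level until it is itself [O(delta_j)].  Since [delta_j] tends
to 0 but has divergent sum, [r_j] tends to 0, and at every limit of alive
angles the partial sums tend to 0 ([alive_cvg]; the passage from an angle to
its neighbours is an Abel summation, [tsum_shift_le]).

It remains to see that the alive population does not die out.  The decrease of
[r] is possible as soon as the block sum [X] at the angle has a component at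
most [-c sigma] along the current partial sum and maximal partial sums at most
[C sigma] ([steer_le], [alive_step]), [sigma^2] being the energy of the block.
By the first, second and fourth moments, at least a fixed proportion of all
children should have both properties ([quartic_le_indicator]).  What makes
this true for most choices of signs is decorrelation between the children.
With [U] the set of children, the averages over [U] of [dot u X],
[(dot u X)^2] and [|X|^4] are functions of independent signs, so their variance
is bounded by the sum of the squared discrete derivatives ([poincare]).  The
derivative in the [n]-th sign is, up to lower order, [a_n] times the [n]-th
Fourier coefficient on [Z/q] of a function supported on [U], so Bessel's
inequality makes the sum of squares smaller by the factor [1/|U|]
([gradient_bound], [variance_bound]).  The maximum over partial sums has
an [n]-dependent derivative and escapes this argument.  It is controlled
instead by bisecting the block according to energy and applying the fourth
moment estimate to every piece ([excess_max4]); fourth powers make the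
resulting geometric series converge.

Hence a generation of [m] alive angles fails to at least quadruple with
probability [O(m^(-1/2))] ([survivors_step]).  The population grows
geometrically, so these probabilities are summable, and their sum is small when
the search starts from a large [N_0] ([expect_fails]).  All these computations
average over finitely many signs; [small_failure_ae] carries them over to the
probability space. *)

(** * Averages over finitely many signs *)

Section Cube.
Variable R : realType.
Implicit Types (s : nat -> bool) (f g : (nat -> bool) -> R) (l : seq nat).

Definition rad (b : bool) : R := if b then 1 else -1.

Definition upd s n b : nat -> bool := fun m => if m == n then b else s m.

Definition avg1 n f : (nat -> bool) -> R :=
  fun s => (f (upd s n true) + f (upd s n false)) / 2.

(** Expectations are operators on functions of an infinite sign sequence that
resample the coordinates in [l] and leave the others alone.  Conditioning on
the past is then just evaluation at a sequence, and induction on [l] replaces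
Fubini. *)
Definition expect l f : (nat -> bool) -> R := foldr avg1 f l.

(** Half the jump in the [n]-th sign: the discrete gradient. *)
Definition partial n f : (nat -> bool) -> R :=
  fun s => (f (upd s n true) - f (upd s n false)) / 2.

Lemma radK b : rad b * rad b = 1.
Proof. by case: b; rewrite /rad ?mulrNN mulr1. Qed.

Lemma upd_same s n b : upd s n b n = b.
Proof. by rewrite /upd eqxx. Qed.

Lemma upd_other s n b m : m != n -> upd s n b m = s m.
Proof. by rewrite /upd => /negbTE ->. Qed.

Lemma upd_upd s n b c : upd (upd s n b) n c = upd s n c.
Proof. by apply/funext => m; rewrite /upd; case: eqP. Qed.

Lemma updC s n m b c : n != m -> upd (upd s n b) m c = upd (upd s m c) n b.
Proof.
move=> cnorm; apply/funext => k; rewrite /upd.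
by case: eqP => [->|//]; rewrite eq_sym (negbTE cnorm).
Qed.

Lemma upd_id s n : upd s n (s n) = s.
Proof. by apply/funext => m; rewrite /upd; case: eqP => // ->. Qed.

Lemma upd_id_eq s n b : s n = b -> upd s n b = s.
Proof. by move=> <-; exact: upd_id. Qed.

Lemma expect_cons n l f s : expect (n :: l) f s =
  (expect l f (upd s n true) + expect l f (upd s n false)) / 2.
Proof. by []. Qed.

Lemma expect_cat l1 l2 f : expect (l1 ++ l2) f = expect l1 (expect l2 f).
Proof. by rewrite /expect foldr_cat. Qed.

(** The sequences that matter agree with [s] outside [l]; this is how the
outcome of earlier blocks is treated as fixed. *)
Lemma expect_le_loc l f g s :
  (forall s', (forall n, n \notin l -> s' n = s n) -> f s' <= g s') ->
  expect l f s <= expect l g s.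
Proof.
elim: l s => [|n l IH] s fg /=; first exact: fg.
have fgb b : expect l f (upd s n b) <= expect l g (upd s n b).
  apply: IH => s' s's; apply: fg => m; rewrite inE negb_or => /andP[mn ml].
  by rewrite s's // upd_other.
by rewrite /avg1 -/(expect _ _) -/(expect _ _); have := fgb true; have := fgb false; lra.
Qed.

Lemma expect_le l f g s : (forall s', f s' <= g s') -> expect l f s <= expect l g s.
Proof. by move=> fg; apply: expect_le_loc. Qed.

Lemma expect_eq_loc l f g s :
  (forall s', (forall n, n \notin l -> s' n = s n) -> f s' = g s') ->
  expect l f s = expect l g s.
Proof.
by move=> fg; apply/eqP; rewrite eq_le; apply/andP; split;
  apply: expect_le_loc => s' /fg ->.
Qed.

Lemma expect_eq l f g s : (forall s', f s' = g s') -> expect l f s = expect l g s.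
Proof. by move=> fg; apply: expect_eq_loc. Qed.

Lemma expectD l f g s : expect l (fun s => f s + g s) s = expect l f s + expect l g s.
Proof.
elim: l s => [|n l IH] s //=; rewrite /avg1 -/(expect _ _) -/(expect _ _) !IH.
by rewrite -/(expect _ _); lra.
Qed.

Lemma expectZ l c f s : expect l (fun s => c * f s) s = c * expect l f s.
Proof.
elim: l s => [|n l IH] s //=; rewrite /avg1 -/(expect _ _) !IH.
by rewrite -/(expect _ _); lra.
Qed.

Lemma expect_cst l c s : expect l (fun=> c) s = c.
Proof. by elim: l s => [|n l IH] s //=; rewrite /avg1 -/(expect _ _) !IH; lra. Qed.

Lemma expectB l f g s : expect l (fun s => f s - g s) s = expect l f s - expect l g s.
Proof.
rewrite -[- expect l g s]mulN1r -expectZ -expectD; apply: expect_eq => s'.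
by rewrite mulN1r.
Qed.

Lemma expect_sum (I : Type) (r : seq I) (P : pred I) (F : I -> (nat -> bool) -> R)
    l s :
  expect l (fun s => \sum_(i <- r | P i) F i s) s = \sum_(i <- r | P i) expect l (F i) s.
Proof.
elim: r => [|i r IH].
  by rewrite big_nil -[RHS](expect_cst l 0 s); apply: expect_eq => s'; rewrite big_nil.
rewrite big_cons -IH; case: ifP => Pi.
  by rewrite -expectD; apply: expect_eq => s'; rewrite big_cons Pi.
by apply: expect_eq => s'; rewrite big_cons Pi.
Qed.

Lemma expect_ge0 l f s : (forall s', 0 <= f s') -> 0 <= expect l f s.
Proof. by move=> f0; rewrite -[leLHS](expect_cst l 0 s); exact: expect_le. Qed.

Lemma expect_upd l f s n b : n \notin l ->
  expect l f (upd s n b) = expect l (fun s => f (upd s n b)) s.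
Proof.
elim: l s => [|m l IH] s //=; rewrite inE negb_or => /andP[cnorm nl].
by rewrite /avg1 -/(expect _ _) -/(expect _ _) !(updC _ _ _ cnorm) !IH.
Qed.

Lemma expect_avg1 n l f s : n \notin l -> expect (n :: l) f s = expect l (avg1 n f) s.
Proof.
move=> nl; rewrite expect_cons !expect_upd // -expectD mulrC -expectZ.
by apply: expect_eq => s'; rewrite /avg1 mulrC.
Qed.

Lemma expect_jensen l f s : (expect l f s) ^+ 2 <= expect l (fun s => f s ^+ 2) s.
Proof.
have := @expect_ge0 l (fun s' => (f s' - expect l f s) ^+ 2) s (fun s' => sqr_ge0 _).
set c := expect l f s.
rewrite (@expect_eq l _ (fun s' => f s' ^+ 2 + ((- 2 * c) * f s' + c ^+ 2))); last first.
  by move=> s'; ring.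
by rewrite expectD expectD expectZ expect_cst -/c; lra.
Qed.

(** Bounds a first absolute moment by a variance bound. *)
Lemma expect_norm_le l f s (v : R) :
  expect l (fun s => f s ^+ 2) s <= v -> expect l (fun s => `|f s|) s <= Num.sqrt v.
Proof.
move=> fv; apply: le_trans (ler_wsqrtr fv).
rewrite -[leLHS]ger0_norm ?expect_ge0// -sqrtr_sqr ler_wsqrtr //.
apply: le_trans (expect_jensen _ _ _) _; apply: expect_le => s'.
by rewrite real_normK ?num_real.
Qed.

Lemma partial_expect n l f s : n \notin l -> partial n (expect l f) s = expect l (partial n f) s.
Proof.
move=> nl; rewrite /partial !expect_upd // -expectB mulrC -expectZ.
by apply: expect_eq => s'; rewrite mulrC.
Qed.

(** The Efron-Stein inequality for independent signs.  Resampling one coordinate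
adds exactly the square of the derivative of the remaining average, and by
Jensen that is at most the average of the squared derivative. *)
Lemma poincare l f s : uniq l ->
  expect l (fun s => f s ^+ 2) s - (expect l f s) ^+ 2 <=
  expect l (fun s => \sum_(n <- l) (partial n f s) ^+ 2) s.
Proof.
elim: l s => [|n l IH] s; first by rewrite /= big_nil subrr.
rewrite cons_uniq => /andP[nl ul]; rewrite !expect_cons.
set G := fun s' => \sum_(m <- l) (partial m f s') ^+ 2.
have cons_sum s' : expect l (fun s' => \sum_(m <- n :: l) (partial m f s') ^+ 2) s'
    = expect l (fun s' => (partial n f s') ^+ 2) s' + expect l G s'.
  by rewrite -expectD; apply: expect_eq => s''; rewrite big_cons.
rewrite !cons_sum.
have pinv b : expect l (fun s' => (partial n f s') ^+ 2) (upd s n b) =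
   expect l (fun s' => (partial n f s') ^+ 2) s.
  by rewrite expect_upd //; apply: expect_eq => s'; rewrite /partial !upd_upd.
rewrite !pinv.
have := IH (upd s n true) ul; have := IH (upd s n false) ul.
have : (partial n (expect l f) s) ^+ 2 <= expect l (fun s' => (partial n f s') ^+ 2) s.
  by rewrite partial_expect //; exact: expect_jensen.
rewrite {1}/partial -/G.
set x := expect l f _; set y := expect l f _.
have -> : ((x - y) / 2) ^+ 2 = (x^+2 + y^+2)/2 - ((x+y)/2)^+2 by field.
by lra.
Qed.

Lemma expect_markov l (A : pred (nat -> bool)) f (c : R) s : 0 < c ->
  (forall s', (forall n, n \notin l -> s' n = s n) -> 0 <= f s') ->
  (forall s', (forall n, n \notin l -> s' n = s n) -> A s' -> c <= f s') ->
  expect l (fun s => (A s)%:R) s <= expect l f s / c.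
Proof.
move=> c0 f0 Af; rewrite ler_pdivlMr // mulrC -expectZ; apply: expect_le_loc => s' s's.
by case: (boolP (A s')) => As /=; rewrite ?mulr1 ?mulr0; [exact: Af|exact: f0].
Qed.

End Cube.

(** * Sums of complex numbers with random signs *)

Section Walk.
Variable R : realType.
Implicit Types (x y z w : R[i]) (c : nat -> R[i]) (s : nat -> bool) (l : seq nat).
Local Notation cRe := (@complex.Re R).
Local Notation cIm := (@complex.Im R).

Definition sqnorm x : R := cRe x ^+ 2 + cIm x ^+ 2.
(** The real scalar product on the plane, that is, the real part of [x^* * y]. *)
Definition dot x y : R := cRe x * cRe y + cIm x * cIm y.

Lemma sqnorm_ge0 x : 0 <= sqnorm x.
Proof. by rewrite addr_ge0 ?sqr_ge0. Qed.

Lemma sqnorm0 : sqnorm 0 = 0.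
Proof. by rewrite /sqnorm /= !expr0n addr0. Qed.

Lemma sqnormM x y : sqnorm (x * y) = sqnorm x * sqnorm y.
Proof. by case: x => a b; case: y => c d; rewrite /sqnorm /=; ring. Qed.

Lemma sqnorm1 : sqnorm 1 = 1.
Proof. by rewrite /sqnorm /= expr1n expr0n addr0. Qed.

Lemma sqnormX x n : sqnorm (x ^+ n) = sqnorm x ^+ n.
Proof. by elim: n => [|n IH]; rewrite ?expr0 ?sqnorm1 // !exprS sqnormM IH. Qed.

Lemma sqnormZ (r : R) x : sqnorm (r%:C * x) = r ^+ 2 * sqnorm x.
Proof. by case: x => a b; rewrite /sqnorm /=; ring. Qed.

Lemma sqnormD x y : sqnorm (x + y) = sqnorm x + sqnorm y + 2 * dot x y.
Proof. by case: x => a b; case: y => c d; rewrite /sqnorm /dot /=; ring. Qed.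

Lemma sqnormB x y : sqnorm (x - y) = sqnorm x + sqnorm y - 2 * dot x y.
Proof. by case: x => a b; case: y => c d; rewrite /sqnorm /dot /=; ring. Qed.

Lemma sqnormB2 x y : sqnorm (x - 2%:R * y) = sqnorm x + 4 * sqnorm y - 4 * dot x y.
Proof. by case: x => a b; case: y => c d; rewrite /sqnorm /dot /=; ring. Qed.

Lemma sqnormJ x : sqnorm x^* = sqnorm x.
Proof. by case: x => a b; rewrite /sqnorm /=; ring. Qed.

Lemma sqnormE x : (sqnorm x)%:C = x * x^*.
Proof.
by case: x => a b; apply/eqP; rewrite eq_complex /sqnorm /=; apply/andP; split;
  apply/eqP; ring.
Qed.

Lemma dotDr x y z : dot x (y + z) = dot x y + dot x z.
Proof. by case: x => ? ?; case: y => ? ?; case: z => ? ?; rewrite /dot /=; ring. Qed.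

Lemma dotBr x y z : dot x (y - z) = dot x y - dot x z.
Proof. by case: x => ? ?; case: y => ? ?; case: z => ? ?; rewrite /dot /=; ring. Qed.

Lemma dotZr (r : R) x y : dot x (r%:C * y) = r * dot x y.
Proof. by case: x => ? ?; case: y => ? ?; rewrite /dot /=; ring. Qed.

Lemma dot2r x y : dot x (2%:R * y) = 2 * dot x y.
Proof. by case: x => ? ?; case: y => ? ?; rewrite /dot /=; ring. Qed.

Lemma dotZl (r : R) x y : dot (r%:C * x) y = r * dot x y.
Proof. by case: x => ? ?; case: y => ? ?; rewrite /dot /=; ring. Qed.

Lemma dotE x y : dot x y = cRe (x^* * y).
Proof. by case: x => ? ?; case: y => ? ?; rewrite /dot /=; ring. Qed.

Lemma dot_sqr_le x y : dot x y ^+ 2 <= sqnorm x * sqnorm y.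
Proof.
case: x => a b; case: y => c d; rewrite /sqnorm /dot /= -subr_ge0.
have -> : (a ^+ 2 + b ^+ 2) * (c ^+ 2 + d ^+ 2) - (a * c + b * d) ^+ 2 =
  (a * d - b * c) ^+ 2 by ring.
exact: sqr_ge0.
Qed.

Lemma sqr_Re_le x : cRe x ^+ 2 <= sqnorm x.
Proof. by rewrite lerDl sqr_ge0. Qed.

Lemma Re_sum (I : Type) (r : seq I) (P : pred I) (F : I -> R[i]) :
  cRe (\sum_(i <- r | P i) F i) = \sum_(i <- r | P i) cRe (F i).
Proof. by apply: big_morph => // x y; case: x; case: y. Qed.

Definition walk l c s : R[i] := \sum_(n <- l) (rad R (s n))%:C * c n.

Definition energy l (c : nat -> R[i]) : R := \sum_(n <- l) sqnorm (c n).

Lemma walk_nil c s : walk [::] c s = 0.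
Proof. exact: big_nil. Qed.

Lemma energy_nil c : energy [::] c = 0.
Proof. exact: big_nil. Qed.

Lemma energy_ge0 l c : 0 <= energy l c.
Proof. by apply: sumr_ge0 => n _; exact: sqnorm_ge0. Qed.

Lemma energy_cons n l c : energy (n :: l) c = sqnorm (c n) + energy l c.
Proof. exact: big_cons. Qed.

Lemma walk_upd_notin l c s n b : n \notin l ->
  walk l c (upd s n b) = walk l c s.
Proof.
move=> nl; apply: eq_big_seq => m ml; rewrite upd_other //.
by apply: contraNneq nl => <-.
Qed.

(** Integrates out one sign explicitly; all moment bounds below are inductions
through this identity. *)
Lemma expect_walk_cons n l (c : nat -> R[i]) (phi : R[i] -> R) s : n \notin l ->
  expect (n :: l) (fun s => phi (walk (n :: l) c s)) s =
  expect l (fun s => (phi (walk l c s + c n) + phi (walk l c s - c n)) / 2) s.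
Proof.
move=> nl; rewrite expect_avg1 //; apply: expect_eq => s'.
rewrite /avg1 /walk !big_cons -!/(walk _ _ _) !walk_upd_notin // !upd_same /rad.
by rewrite rmorphN rmorph1 mulN1r mul1r addrC [- _ + _]addrC [c n + _]addrC addrC.
Qed.

Lemma expect_walk_dot u l c s : uniq l ->
  expect l (fun s => dot u (walk l c s)) s = 0.
Proof.
elim: l => [|n l IH]; first by rewrite /walk /= big_nil /dot /= !mulr0 addr0.
rewrite cons_uniq => /andP[nl ul]; rewrite (expect_walk_cons _ _ _ nl) -(IH ul).
by apply: expect_eq => s'; rewrite dotDr dotBr; field.
Qed.

Lemma expect_walk_dot2 u l c s : uniq l ->
  expect l (fun s => dot u (walk l c s) ^+ 2) s = \sum_(n <- l) dot u (c n) ^+ 2.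
Proof.
elim: l => [|n l IH]; first by rewrite /walk /= !big_nil /dot /= !mulr0 addr0 expr0n.
rewrite cons_uniq => /andP[nl ul].
rewrite (expect_walk_cons _ (fun x => dot u x ^+ 2) _ nl) big_cons -(IH ul).
rewrite -[X in X + _](expect_cst l _ s) -expectD.
by apply: expect_eq => s'; rewrite dotDr dotBr; field.
Qed.

Lemma expect_walk_nsq l c s : uniq l ->
  expect l (fun s => sqnorm (walk l c s)) s = energy l c.
Proof.
elim: l => [|n l IH]; first by rewrite /walk /energy /= !big_nil sqnorm0.
rewrite cons_uniq => /andP[nl ul]; rewrite (expect_walk_cons _ _ _ nl) energy_cons -(IH ul).
rewrite -[X in X + _](expect_cst l _ s) -expectD.
by apply: expect_eq => s'; rewrite sqnormD sqnormB; field.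
Qed.

Lemma expect_walk_4 l c s : uniq l ->
  expect l (fun s => sqnorm (walk l c s) ^+ 2) s <= 3 * energy l c ^+ 2.
Proof.
elim: l => [|n l IH]; first by rewrite /walk /energy /= !big_nil sqnorm0 expr0n mulr0.
rewrite cons_uniq => /andP[nl ul].
rewrite (expect_walk_cons _ (fun x => sqnorm x ^+ 2) _ nl) energy_cons.
set C := sqnorm (c n); set V := energy l c.
apply: (@le_trans _ _ (3 * V ^+ 2 + (6 * C * V + C ^+ 2))); last first.
  have C0 : 0 <= C := sqnorm_ge0 _.
  by rewrite /C /V in C0 *; have := sqr_ge0 (sqnorm (c n)); lra.
apply: le_trans (lerD (IH ul) (lexx _)).
rewrite /V -(expect_walk_nsq c s ul) -expectZ -[X in _ + (_ + X)](expect_cst l _ s) -!expectD.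
apply: expect_le => s'; rewrite sqnormD sqnormB -/C.
have := dot_sqr_le (walk l c s') (c n); rewrite -/C.
set d := dot _ _; set x := sqnorm _ => dx.
by have -> : ((x + C + 2 * d) ^+ 2 + (x + C - 2 * d) ^+ 2) / 2 =
  (x + C) ^+ 2 + 4 * d ^+ 2; [field|lra].
Qed.

Lemma expect_walk_6 l c s : uniq l ->
  expect l (fun s => sqnorm (walk l c s) ^+ 3) s <= 15 * energy l c ^+ 3.
Proof.
elim: l => [|n l IH]; first by rewrite /walk /energy /= !big_nil sqnorm0 expr0n mulr0.
rewrite cons_uniq => /andP[nl ul].
rewrite (expect_walk_cons _ (fun x => sqnorm x ^+ 3) _ nl) energy_cons.
set C := sqnorm (c n); set V := energy l c.
have C0 : 0 <= C := sqnorm_ge0 _.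
have V0 : 0 <= V := energy_ge0 _ _.
apply: (@le_trans _ _ (15 * V ^+ 3 + ((15 * C) * (3 * V ^+ 2)
    + ((15 * C ^+ 2) * V + C ^+ 3)))); last first.
  have h1 : 0 <= V * C ^+ 2 by rewrite mulr_ge0 ?sqr_ge0.
  have h2 : 0 <= C ^+ 3 by rewrite exprn_ge0.
  by lra.
apply: le_trans (lerD (IH ul) (lerD (ler_wpM2l _ (expect_walk_4 c s ul)) (lexx _))).
  2: by rewrite mulr_ge0.
rewrite /V -(expect_walk_nsq c s ul) -!expectZ -[X in _ + (_ + (_ + X))](expect_cst l _ s) -!expectD.
apply: expect_le => s'; rewrite sqnormD sqnormB -/C.
have := dot_sqr_le (walk l c s') (c n); rewrite -/C.
have := sqnorm_ge0 (walk l c s').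
set d := dot _ _; set x := sqnorm _ => x0 dx.
have -> : ((x + C + 2 * d) ^+ 3 + (x + C - 2 * d) ^+ 3) / 2 =
  (x + C) ^+ 3 + 12 * (x + C) * d ^+ 2 by field.
have : (x + C) * d ^+ 2 <= (x + C) * (x * C).
  by apply: ler_wpM2l => //; rewrite addr_ge0.
by lra.
Qed.

(** Starting the walk at an arbitrary point [x] makes the statement inductive: one
sign step replaces the squared norm of [x] by its mean, which is larger by the energy of that step, so
the right-hand side is preserved. *)
Lemma kolmogorov l (c : nat -> R[i]) x (v : R) s : uniq l -> 0 < v ->
  expect l (fun s => (has (fun i => v <= sqnorm (x + walk (take i l) c s))
                      (iota 0 (size l).+1))%:R) s
    <= (sqnorm x + energy l c) / v.
Proof.
move=> ul v0; elim: l x s ul => [|n l IH] x s.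
  rewrite /energy /walk /= !big_nil !addr0 orbF => _.
  case: (boolP (v <= sqnorm x)) => h; first by rewrite ler_pdivlMr ?mul1r.
  by rewrite divr_ge0 ?sqnorm_ge0 ?ltW.
rewrite cons_uniq => /andP[nl ul]; rewrite energy_cons.
have [xv|xv] := boolP (v <= sqnorm x).
  apply: (@le_trans _ _ 1); last first.
    rewrite ler_pdivlMr // mul1r (le_trans xv) // lerDl addr_ge0 ?sqnorm_ge0//.
    exact: energy_ge0.
  rewrite -[leRHS](expect_cst (n :: l) 1 s); apply: expect_le => s'.
  by rewrite lern1 leq_b1.
rewrite expect_avg1 //.
pose f y s' : R := (has (fun i => v <= sqnorm (y + walk (take i l) c s'))
                      (iota 0 (size l).+1))%:R.
apply: (@le_trans _ _ (2^-1 * expect l (f (x + c n)) s + 2^-1 * expect l (f (x - c n)) s)).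
  rewrite -!expectZ -expectD; apply: expect_le => s'; rewrite /avg1.
  have stepE b : has (fun i => v <= sqnorm (x + walk (take i (n :: l)) c (upd s' n b)))
      (iota 0 (size (n :: l)).+1) =
    has (fun i => v <= sqnorm ((x + (rad R b)%:C * c n) + walk (take i l) c s'))
      (iota 0 (size l).+1).
    have hc (T : Type) (a : pred T) (y : T) r : has a (y :: r) = a y || has a r by [].
    rewrite -[iota 0 _]/(0%N :: iota (1 + 0) (size l).+1) hc iotaDl has_map.
    rewrite take0 [walk [::] _ _]/walk big_nil addr0 (negbTE xv) orFb.
    apply: eq_has => i; rewrite /preim /= -/(walk _ _ _).
    rewrite {1}/walk big_cons -/(walk _ _ _) upd_same addrA walk_upd_notin //.
    by apply: contra nl; exact: mem_take.
  by rewrite !stepE /rad rmorphN rmorph1 mul1r mulN1r /f; lra.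
have := IH (x + c n) s ul; have := IH (x - c n) s ul.
rewrite -/(f (x + c n)) -/(f (x - c n)) sqnormB sqnormD.
set e1 := expect _ _ _; set e2 := expect _ _ _.
rewrite !ler_pdivlMr // => h1 h2; lra.
Qed.
End Walk.

(** * Bessel's inequality and variances of averages over grid points *)

Section Fourier.
Variable R : realType.
Implicit Types (x y z w : R[i]) (c : nat -> R[i]) (s : nat -> bool) (l : seq nat).

Lemma cauchy_schwarz_sum (I : Type) (r : seq I) (P : pred I) (x y : I -> R) :
  (\sum_(i <- r | P i) x i * y i) ^+ 2 <=
  (\sum_(i <- r | P i) x i ^+ 2) * \sum_(i <- r | P i) y i ^+ 2.
Proof.
have : 0 <= \sum_(i <- r | P i) \sum_(j <- r | P j) (x i * y j - x j * y i) ^+ 2.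
  by do 2![apply: sumr_ge0 => ? _]; exact: sqr_ge0.
under eq_bigr => i _.
  under eq_bigr => j _.
    rewrite (_ : _ ^+ 2 = x i ^+ 2 * y j ^+ 2 +
      (y i ^+ 2 * x j ^+ 2 + (- 2 * (x i * y i)) * (x j * y j))); last ring.
    over.
  rewrite !big_split /=; over.
rewrite !big_split /= -!big_distrlr /= -mulr_sumr.
set A := \sum_(i <- r | P i) x i ^+ 2; set B := \sum_(i <- r | P i) y i ^+ 2.
by set S := \sum_(i <- r | P i) x i * y i; lra.
Qed.

Lemma sum_sqr_le (I : Type) (r : seq I) (P : pred I) (h : I -> R) (m : R) :
  \sum_(i <- r | P i) 1 <= m ->
  (\sum_(i <- r | P i) h i) ^+ 2 <= m * \sum_(i <- r | P i) h i ^+ 2.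
Proof.
move=> cnorm; have Q0 : 0 <= \sum_(i <- r | P i) h i ^+ 2.
  by apply: sumr_ge0 => i _; exact: sqr_ge0.
apply: le_trans (ler_wpM2r Q0 cnorm).
have := cauchy_schwarz_sum r P (fun=> 1) h.
by under eq_bigr do rewrite mul1r; under [X in _ <= X * _]eq_bigr do rewrite expr1n.
Qed.

Lemma sum1_le q (U : pred nat) : \sum_(k < q | U k) (1 : R) <= q%:R.
Proof.
rewrite -[q in leRHS]card_ord -sum1_card natr_sum [leRHS](bigID (fun k : 'I_q => U k)) /=.
by rewrite lerDl sumr_ge0.
Qed.

(** Plancherel on [Z/q], the frequencies and points being read through the powers
of a primitive root. *)
Lemma parseval (q : nat) w (h : nat -> R[i]) : q.-primitive_root w -> sqnorm w = 1 ->
  \sum_(m < q) sqnorm (\sum_(k < q) h k * (w ^+ k) ^+ m) =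
  q%:R * \sum_(k < q) sqnorm (h k).
Proof.
move=> prw w1.
have q0 : (0 < q)%N := prim_order_gt0 prw.
have wJ : w * w^* = 1 by rewrite -sqnormE w1.
apply: (@complexI R).
rewrite rmorphM rmorph_nat !rmorph_sum /=.
under eq_bigr => m _.
  rewrite sqnormE rmorph_sum big_distrlr /=.
  over.
rewrite exchange_big mulr_sumr /=; apply: eq_bigr => k _.
rewrite exchange_big /= (bigD1 k) //= [X in _ + X]big1 ?addr0; last first.
  move=> k' k'k.
  set v := w ^+ k * w^* ^+ k'.
  rewrite (eq_bigr (fun m : 'I_q => (h k * (h k')^*) * v ^+ m)); last first.
    by move=> m _; rewrite rmorphM !rmorphXn /= /v exprMn; ring.
  rewrite -mulr_sumr; apply/eqP; rewrite mulf_eq0; apply/orP; right.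
  have v1 : v != 1.
    apply: contra k'k => /eqP v1.
    have : w ^+ k == w ^+ k'.
      have -> : w ^+ k = v * w ^+ k'.
        by rewrite /v -mulrA -exprMn [w^* * w]mulrC wJ expr1n mulr1.
      by rewrite v1 mul1r.
    by rewrite (eq_prim_root_expr prw) !modn_small // eq_sym => /eqP/val_inj ->.
  have : v ^+ q - 1 = 0.
    rewrite /v exprMn [w ^+ k ^+ q]exprAC (prim_expr_order prw) expr1n mul1r.
    by rewrite exprAC -rmorphXn /= (prim_expr_order prw) rmorph1 expr1n subrr.
  rewrite subrX1 => /eqP; rewrite mulf_eq0 subr_eq0 (negbTE v1) /=.
  by [].
rewrite (eq_bigr (fun=> (sqnorm (h k))%:C)).
  by rewrite sumr_const card_ord mulr_natl.
move=> m _; rewrite sqnormE rmorphM !rmorphXn /=.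
have e : (w ^+ k) ^+ m * (w^* ^+ k) ^+ m = 1.
  by rewrite -!exprMn wJ !expr1n.
by rewrite mulrACA e mulr1.
Qed.

(** Restricting Plancherel to the points in [U] and the frequencies in [r]; the
right-hand side counts only [U], which is the source of all decorrelation
between grid points. *)
Lemma bessel (q : nat) w (U : pred nat) (h : nat -> R[i]) (r : seq nat) :
  q.-primitive_root w -> sqnorm w = 1 -> uniq r -> all (fun m => (m < q)%N) r ->
  \sum_(m <- r) sqnorm (\sum_(k < q | U k) h k * (w ^+ k) ^+ m) <=
  q%:R * \sum_(k < q | U k) sqnorm (h k).
Proof.
move=> prw w1 ur rq.
pose h' k := if U k then h k else 0.
have TE m : \sum_(k < q | U k) h k * (w ^+ k) ^+ m =
            \sum_(k < q) h' k * (w ^+ k) ^+ m.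
  by rewrite big_mkcond; apply: eq_bigr => k _; rewrite /h'; case: ifP; rewrite ?mul0r.
have hE : \sum_(k < q | U k) sqnorm (h k) = \sum_(k < q) sqnorm (h' k).
  by rewrite big_mkcond; apply: eq_bigr => k _; rewrite /h'; case: ifP; rewrite ?sqnorm0.
rewrite hE -(parseval h' prw w1).
rewrite -(big_mkord xpredT (fun m => sqnorm (\sum_(k < q) h' k * (w ^+ k) ^+ m))).
rewrite [leLHS](eq_bigr (fun m => sqnorm (\sum_(k < q) h' k * (w ^+ k) ^+ m))); last first.
  by move=> m _; rewrite TE.
rewrite [leRHS](bigID (mem r)) /= -[X in _ <= X + _]big_filter.
rewrite [X in _ <= X + _](perm_big r) /=; first by rewrite lerDl sumr_ge0 // => m _; exact: sqnorm_ge0.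
apply: uniq_perm => //; first by rewrite filter_uniq // iota_uniq.
move=> m; rewrite mem_filter mem_index_iota /=.
by case: (boolP (m \in r)) => //= mr; rewrite (allP rq).
Qed.

Lemma walk_flip l c s n : n \in l -> uniq l ->
  walk l c (upd s n (~~ s n)) = walk l c s - 2%:R * ((rad R (s n))%:C * c n).
Proof.
move=> nl ul; rewrite /walk (bigD1_seq n) //= [in RHS](bigD1_seq n) //=.
rewrite (eq_bigr (fun m => (rad R (s m))%:C * c m)).
  by rewrite upd_same; case: (s n); rewrite /rad /= rmorphN; ring.
by move=> m mn; rewrite upd_other.
Qed.

Section Gradient.
Variables (q : nat) (w : R[i]) (U : pred nat) (b : nat -> R[i]) (l : seq nat).
Variables (tau V : R).
Hypotheses (prw : q.-primitive_root w) (w1 : sqnorm w = 1).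
Hypotheses (ul : uniq l) (lq : all (fun m => (m < q)%N) l).
Hypotheses (tau0 : 0 <= tau) (btau : forall n, n \in l -> sqnorm (b n) <= tau).

Definition mode w b k (n : nat) : R[i] := b n * (w ^+ k) ^+ n.

Lemma sqnorm_mode k n : sqnorm (mode w b k n) = sqnorm (b n).
Proof. by rewrite /mode sqnormM !sqnormX w1 !expr1n mulr1. Qed.

Definition modesum (f : nat -> R[i] -> R) s : R :=
  \sum_(k < q | U k) f k (walk l (mode w b k) s).

Lemma modesumE f s :
  modesum f s = \sum_(k < q | U k) f k (walk l (mode w b k) s).
Proof. by []. Qed.

Lemma modesum_expect f s : expect l (modesum f) s =
  \sum_(k < q | U k) expect l (fun s => f k (walk l (mode w b k) s)) s.
Proof. exact: expect_sum. Qed.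

Lemma energy_mode k : energy l (mode w b k) = energy l b.
Proof. by apply: eq_bigr => n _; exact: sqnorm_mode. Qed.

(** The [n]-th inner sum is the real part of [b n] times a Fourier coefficient of
[k |-> (g k)^*] on [U]. *)
Lemma sum_dot_mode_le (g : nat -> R[i]) :
  \sum_(n <- l) (\sum_(k < q | U k) dot (g k) (mode w b k n)) ^+ 2 <=
  tau * (q%:R * \sum_(k < q | U k) sqnorm (g k)).
Proof.
have -> : \sum_(k < q | U k) sqnorm (g k) = \sum_(k < q | U k) sqnorm (g k)^*.
  by apply: eq_bigr => k _; rewrite sqnormJ.
apply: (@le_trans _ _ (tau * \sum_(n <- l) sqnorm (\sum_(k < q | U k) (g k)^* * (w ^+ k) ^+ n))).
  rewrite mulr_sumr !big_seq; apply: ler_sum => n nl.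
  apply: (@le_trans _ _ (sqnorm (b n) * sqnorm (\sum_(k < q | U k) (g k)^* * (w ^+ k) ^+ n))).
    rewrite -sqnormM; apply: le_trans (sqr_Re_le _).
    rewrite mulr_sumr Re_sum le_eqVlt; apply/orP; left; apply/eqP; congr (_ ^+ 2).
    by apply: eq_bigr => k _; rewrite dotE /mode mulrCA.
  by rewrite ler_wpM2r ?sqnorm_ge0 ?btau.
rewrite ler_wpM2l //.
exact: (bessel U (fun k => (g k)^*) prw w1 ul lq).
Qed.

(** Here [g] is the gradient of [f] and [h] bounds the second-order error.  Flipping
the [n]-th sign moves all the walks by twice the [n]-th mode, so the main part of
the derivative is a Fourier coefficient, summed by Bessel; the error is of order
[sqnorm (b n)] and is summed by Cauchy-Schwarz. *)
Lemma gradient_bound (f h : nat -> R[i] -> R) (g : nat -> R[i] -> R[i]) s :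
  energy l b <= V ->
  (forall k x y, sqnorm y <= V ->
     `|(f k x - f k (x - 2%:R * y)) / 2 - dot (g k x) y| <= sqnorm y * h k x) ->
  \sum_(n <- l) (partial n (modesum f) s) ^+ 2
  <= (2 * tau * q%:R) * \sum_(k < q | U k)
       (sqnorm (g k (walk l (mode w b k) s)) + V * h k (walk l (mode w b k) s) ^+ 2).
Proof.
move=> bV fgh.
pose X k := walk l (mode w b k) s.
pose D n := \sum_(k < q | U k) dot (g k (X k)) (mode w b k n).
pose H := \sum_(k < q | U k) h k (X k).
have sqnormV n : n \in l -> sqnorm (b n) <= V.
  move=> nl; apply: le_trans bV; rewrite /energy (bigD1_seq n) //= lerDl.
  by apply: sumr_ge0 => m _; exact: sqnorm_ge0.
have step n : n \in l ->
  (partial n (modesum f) s) ^+ 2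
  <= 2 * D n ^+ 2 + 2 * (sqnorm (b n) ^+ 2 * H ^+ 2).
  move=> nl.
  pose y k := (rad R (s n))%:C * mode w b k n.
  pose P := \sum_(k < q | U k) (f k (X k) - f k (X k - 2%:R * y k)) / 2.
  have -> : (partial n (modesum f) s) ^+ 2
     = P ^+ 2.
    have flipE : P = (\sum_(k < q | U k) f k (walk l (mode w b k) s) -
        \sum_(k < q | U k) f k (walk l (mode w b k) (upd s n (~~ s n)))) / 2.
      rewrite /P -sumrB mulr_suml; apply: eq_bigr => k _.
      by rewrite walk_flip.
    rewrite flipE /partial; case sn: (s n) => /=.
      by rewrite [upd s n true]upd_id_eq.
    by rewrite [upd s n false]upd_id_eq // -[LHS]sqrrN -mulNr opprB.
  pose S := \sum_(k < q | U k) dot (g k (X k)) (y k).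
  have SE : S = rad R (s n) * D n.
    by rewrite /S /D mulr_sumr; apply: eq_bigr => k _; rewrite dotZr.
  have S2 : S ^+ 2 = D n ^+ 2 by rewrite SE exprMn expr2 radK mul1r.
  have yb k : sqnorm (y k) = sqnorm (b n).
    by rewrite /y sqnormZ expr2 radK mul1r sqnorm_mode.
  have PS : `|P - S| <= sqnorm (b n) * H.
    rewrite /P /S -sumrB /H mulr_sumr; apply: le_trans (ler_norm_sum _ _ _) _.
    by apply: ler_sum => k _; rewrite -(yb k); apply: fgh; rewrite yb sqnormV.
  have {}PS : (P - S) ^+ 2 <= sqnorm (b n) ^+ 2 * H ^+ 2.
    rewrite -exprMn -(real_normK (num_real (P - S))) lerXn2r ?nnegrE //.
    exact: le_trans PS.
  rewrite -S2; have := sqr_ge0 (P - 2 * S); move: PS; lra.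
apply: (@le_trans _ _ (2 * \sum_(n <- l) D n ^+ 2 + 2 * (tau * V) * H ^+ 2)).
  apply: (@le_trans _ _ (\sum_(n <- l) (2 * D n ^+ 2 + 2 * (tau * sqnorm (b n) * H ^+ 2)))).
    rewrite !big_seq; apply: ler_sum => n nl; apply: le_trans (step n nl) _.
    rewrite lerD2l ler_wpM2l // ler_wpM2r ?sqr_ge0 //.
    by rewrite expr2 ler_wpM2r ?sqnorm_ge0 ?btau.
  rewrite big_split /= -mulr_sumr lerD2l -mulr_sumr -mulr_suml -mulr_sumr.
  rewrite -/(energy l b) mulrA ler_wpM2r ?sqr_ge0 // ler_wpM2l // ler_wpM2l //.
have HH : H ^+ 2 <= q%:R * \sum_(k < q | U k) h k (X k) ^+ 2.
  by apply: sum_sqr_le; exact: sum1_le.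
have V0 : 0 <= V by apply: le_trans bV; exact: energy_ge0.
have DD : \sum_(n <- l) D n ^+ 2 <= tau * (q%:R * \sum_(k < q | U k) sqnorm (g k (X k))).
  exact: (sum_dot_mode_le (fun k => g k (X k))).
rewrite [X in _ <= _ * X]big_split /= -[X in _ <= _ * (_ + X)]mulr_sumr.
have : (tau * V) * H ^+ 2 <= (tau * V) * (q%:R * \sum_(k < q | U k) h k (X k) ^+ 2).
  by rewrite ler_wpM2l // mulr_ge0.
move: DD; rewrite -/(X _).
set a := \sum_(n <- l) _; set a1 := \sum_(k < q | U k) _; set a2 := \sum_(k < q | U k) _.
by move=> h1 h2; lra.
Qed.

Lemma variance_bound (f h : nat -> R[i] -> R) (g : nat -> R[i] -> R[i]) s B :
  energy l b <= V ->
  (forall k x y, sqnorm y <= V ->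
     `|(f k x - f k (x - 2%:R * y)) / 2 - dot (g k x) y| <= sqnorm y * h k x) ->
  (forall k, expect l (fun s => sqnorm (g k (walk l (mode w b k) s))
               + V * h k (walk l (mode w b k) s) ^+ 2) s <= B) ->
  expect l (fun s' => (modesum f s' - expect l (modesum f) s) ^+ 2) s <=
   (2 * tau * q%:R) * (B * \sum_(k < q | U k) 1).
Proof.
move=> bV fgh gB; set F := modesum f.
have V0 : 0 <= V by apply: le_trans bV; exact: energy_ge0.
have -> : expect l (fun s' => (F s' - expect l F s) ^+ 2) s =
    expect l (fun s' => F s' ^+ 2) s - expect l F s ^+ 2.
  set e := expect l F s.
  rewrite (@expect_eq R l _ (fun s' => F s' ^+ 2 + ((- 2 * e) * F s' + e ^+ 2))); last first.
    by move=> s'; ring.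
  by rewrite expectD expectD expectZ expect_cst -/e; ring.
apply: le_trans (poincare _ _ ul) _.
apply: (@le_trans _ _ (expect l (fun s => (2 * tau * q%:R) * \sum_(k < q | U k)
       (sqnorm (g k (walk l (mode w b k) s)) + V * h k (walk l (mode w b k) s) ^+ 2)) s)).
  by apply: expect_le => s'; exact: gradient_bound.
rewrite expectZ ler_wpM2l ?mulr_ge0 // expect_sum mulr_sumr.
by apply: ler_sum => k _; rewrite mulr1.
Qed.
End Gradient.

End Fourier.

(** * Concentration of averaged moments and maxima *)

Section Moricz.
Variable R : realType.
Implicit Types (x y z w : R[i]) (b c : nat -> R[i]) (s : nat -> bool) (l : seq nat).

(** The coefficient in front of [y] is close to 1, so that splitting off a prefix
costs little in the recursion of [excess_max4]. *)
Lemma sqnormD_sqr_le x y : sqnorm (x + y) ^+ 2 <= 7 / 6 * sqnorm y ^+ 2 + 20 ^+ 3 * sqnorm x ^+ 2.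
Proof.
have xy : sqnorm (x + y) <= 20 / 19 * sqnorm y + 20 * sqnorm x.
  case: x => a b; case: y => c d; rewrite /sqnorm /=.
  have := sqr_ge0 (c - 19 * a); have := sqr_ge0 (d - 19 * b); lra.
apply: (@le_trans _ _ ((20 / 19 * sqnorm y + 20 * sqnorm x) ^+ 2)).
  by rewrite lerXn2r ?nnegrE ?sqnorm_ge0 // (le_trans (sqnorm_ge0 _) xy).
by have := sqr_ge0 (sqnorm y - 360 * sqnorm x); have := sqr_ge0 (sqnorm x);
  have := sqr_ge0 (sqnorm y); lra.
Qed.

Lemma expect_loc l (f : (nat -> bool) -> R) s :
  (forall s', (forall n, n \notin l -> s' n = s n) -> f s' = f s) -> expect l f s = f s.
Proof. by move=> fs; rewrite (expect_eq_loc fs) expect_cst. Qed.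

Lemma walk_cat l1 l2 c s : walk (l1 ++ l2) c s = walk l1 c s + walk l2 c s.
Proof. exact: big_cat. Qed.

Lemma eq_walk l c s s' : (forall n, n \in l -> s n = s' n) -> walk l c s = walk l c s'.
Proof. by move=> ss'; apply: eq_big_seq => n /ss' ->. Qed.

Lemma energy_cat l1 l2 c : energy (l1 ++ l2) c = energy l1 c + energy l2 c.
Proof. exact: big_cat. Qed.

(** Fourth powers, because their bounds are summable over repeated bisections
while those of the squares are not. *)
Definition max4 l c s : R :=
  \big[Num.max/0]_(i < (size l).+1) sqnorm (walk (take i l) c s) ^+ 2.

Lemma max4_ge0 l c s : 0 <= max4 l c s.
Proof. exact: bigmax_ge_id. Qed.

Lemma prefix_le_max4 l c s i : sqnorm (walk (take i l) c s) ^+ 2 <= max4 l c s.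
Proof.
pose F (j : 'I_(size l).+1) := sqnorm (walk (take j l) c s) ^+ 2.
have [il|il] := leqP i (size l).
  exact: (le_bigmax 0 F (Ordinal (il : (i < (size l).+1)%N))).
rewrite take_oversize ?(ltnW il) // -{1}(take_size l).
exact: (le_bigmax 0 F ord_max).
Qed.

Lemma max4_le l c s (B : R) : 0 <= B ->
  (forall i, (i <= size l)%N -> sqnorm (walk (take i l) c s) ^+ 2 <= B) -> max4 l c s <= B.
Proof. by move=> B0 iB; apply: bigmax_le => // i _; apply: iB; rewrite -ltnS. Qed.

Lemma eq_max4 l c s s' : (forall n, n \in l -> s n = s' n) -> max4 l c s = max4 l c s'.
Proof.
move=> ss'; apply: eq_bigr => i _; rewrite (@eq_walk _ _ s s') // => n /mem_take.
exact: ss'.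
Qed.

Lemma max4_nil c s : max4 [::] c s = 0.
Proof. by rewrite /max4 big_ord_recl big_ord0 /= walk_nil sqnorm0 expr0n maxxx. Qed.

(* Linear arithmetic compares atoms up to conversion; these must stay atoms. *)
Local Opaque max4 walk sqnorm dot energy modesum.

(** A prefix either stays in [l1] or consists of [rcons l1 n] and a prefix of [l2]. *)
Lemma max4_split l1 n l2 c s : max4 (l1 ++ n :: l2) c s <=
  max4 l1 c s + (7 / 6 * max4 l2 c s + 20 ^+ 3 * sqnorm (walk (rcons l1 n) c s) ^+ 2).
Proof.
have m1 := max4_ge0 l1 c s; have m2 := max4_ge0 l2 c s.
have n0 := sqr_ge0 (sqnorm (walk (rcons l1 n) c s)).
apply: max4_le => [|i _]; first by do 2![apply: addr_ge0 => //]; apply: mulr_ge0.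
have [il|il] := leqP i (size l1).
  have -> : take i (l1 ++ n :: l2) = take i l1.
    rewrite take_cat; case: ltnP il => // li il.
    have -> : i = size l1 by apply/eqP; rewrite eqn_leq il li.
    by rewrite subnn take0 cats0 take_size.
  apply: le_trans (prefix_le_max4 l1 c s i) _.
  by rewrite lerDl; apply: addr_ge0; apply: mulr_ge0.
have -> : take i (l1 ++ n :: l2) = rcons l1 n ++ take (i - size l1).-1 l2.
  rewrite take_cat ltnNge (ltnW il) /=; case e: (i - size l1)%N => [|j] /=.
    by move/eqP: e; rewrite subn_eq0 leqNgt il.
  by rewrite -cats1 -catA.
rewrite walk_cat; apply: le_trans (sqnormD_sqr_le _ _) _.
rewrite -[leLHS]add0r lerD // lerD2r ler_wpM2l //.
exact: prefix_le_max4.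
Qed.

(** A list can be cut at one index so that both remaining parts carry at most a
prescribed share of the energy, whatever the size of the removed term. *)
Lemma energy_split l c t : l != [::] -> 0 <= t <= energy l c ->
  exists l1 n l2, [/\ l = l1 ++ n :: l2, energy l1 c <= t &
                      energy l2 c <= energy l c - t].
Proof.
elim: l t => // n l IH t _ /andP[t0 tV].
have [nt|nt] := leP t (sqnorm (c n)).
  exists [::], n, l; split => //; first by rewrite energy_nil.
  by rewrite energy_cons; lra.
rewrite energy_cons in tV *.
have t'V : 0 <= t - sqnorm (c n) <= energy l c by apply/andP; split; lra.
have l0 : l != [::].
  by apply: contraTneq tV => ->; rewrite energy_nil addr0 -ltNge.
have [l1 [m [l2 [-> h1 h2]]]] := IH _ l0 t'V.
exists (n :: l1), m, l2; split => //; first by rewrite energy_cons; lra.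
by move: h2; lra.
Qed.

Section Concentration.
Variables (q : nat) (w : R[i]) (U : pred nat) (b : nat -> R[i]) (tau : R).
Hypotheses (prw : q.-primitive_root w) (w1 : sqnorm w = 1) (tau0 : 0 <= tau).
Local Notation Nu := (\sum_(k < q | U k) (1 : R)).

Lemma Nu_ge0 : 0 <= Nu. Proof. exact: sumr_ge0. Qed.

Lemma mean_dot l (u : nat -> R[i]) s : uniq l -> all (fun m => (m < q)%N) l ->
  (forall n, n \in l -> sqnorm (b n) <= tau) -> (forall k, sqnorm (u k) = 1) ->
  expect l (fun s => `|modesum q w U b l (fun k x => dot (u k) x) s|) s <=
  Num.sqrt (2 * (tau * q%:R * Nu)).
Proof.
move=> ul lq bt u1; apply: expect_norm_le.
have E0 : expect l (modesum q w U b l (fun k x => dot (u k) x)) s = 0.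
  by rewrite modesum_expect big1 // => k _; exact: expect_walk_dot.
apply: (@le_trans _ _ (expect l (fun s' =>
    (modesum q w U b l (fun k x => dot (u k) x) s' -
     expect l (modesum q w U b l (fun k x => dot (u k) x)) s) ^+ 2) s)).
  by apply: expect_le => s'; rewrite E0 subr0.
have -> : 2 * (tau * q%:R * Nu) = 2 * tau * q%:R * (1 * Nu) by ring.
apply: (@variance_bound R q w U b l tau _ prw w1 ul lq tau0 bt
  (fun k x => dot (u k) x) (fun _ _ => 0) (fun k _ => u k) s 1 (lexx _)).
  move=> k x y _; rewrite mulr0 dotBr dot2r.
  by rewrite (_ : _ - _ = 0) ?normr0 //; field.
by move=> k; rewrite expect_cst u1 expr0n mulr0 addr0.
Qed.

(** Instance of [variance_bound] with gradient [2 (dot u x) u] and constant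
second-order error. *)
Lemma mean_dot2 l (u : nat -> R[i]) s : uniq l -> all (fun m => (m < q)%N) l ->
  (forall n, n \in l -> sqnorm (b n) <= tau) -> (forall k, sqnorm (u k) = 1) ->
  expect l (fun s' => `|modesum q w U b l (fun k x => dot (u k) x ^+ 2) s' -
      expect l (modesum q w U b l (fun k x => dot (u k) x ^+ 2)) s|) s <=
  Num.sqrt (16 * energy l b * (tau * q%:R * Nu)).
Proof.
move=> ul lq bt u1; apply: expect_norm_le.
have V0 := energy_ge0 l b.
have -> : 16 * energy l b * (tau * q%:R * Nu) =
  2 * tau * q%:R * (8 * energy l b * Nu) by ring.
apply: (@variance_bound R q w U b l tau _ prw w1 ul lq tau0 bt
  (fun k x => dot (u k) x ^+ 2) (fun _ _ => 2)
  (fun k x => (2 * dot (u k) x)%:C * u k) s _ (lexx _)).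
  move=> k x y _; rewrite dotBr dot2r dotZl.
  rewrite (_ : _ - _ = - (2 * dot (u k) y ^+ 2)); last by field.
  have d0 := sqr_ge0 (dot (u k) y).
  rewrite normrN ger0_norm; last exact: mulr_ge0.
  by have := dot_sqr_le (u k) y; rewrite u1 mul1r; lra.
move=> k.
rewrite (@expect_eq R l _ (fun s' => 4 * dot (u k) (walk l (mode w b k) s') ^+ 2
   + 4 * energy l b)); last first.
  by move=> s'; rewrite sqnormZ u1; ring.
rewrite expectD expectZ expect_cst expect_walk_dot2 //.
suff : \sum_(n <- l) dot (u k) (mode w b k n) ^+ 2 <= energy l b by lra.
by apply: ler_sum => n _; apply: le_trans (dot_sqr_le _ _) _; rewrite u1 mul1r sqnorm_mode.
Qed.

(** Mean at most [3 V^2] by [expect_walk_4]; the variance needs the sixth moment,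
as the gradient of the fourth power is cubic.  The bound is of order [V^(3/2)],
an exponent larger than 1, which is what lets [excess_max4] sum it over pieces. *)
Lemma excess_sqnorm2 l s : uniq l -> all (fun m => (m < q)%N) l ->
  (forall n, n \in l -> sqnorm (b n) <= tau) ->
  expect l (fun s' => Num.max 0 (modesum q w U b l (fun k x => sqnorm x ^+ 2) s'
          - 3 * energy l b ^+ 2 * Nu)) s <=
  80 * (Num.sqrt (tau * q%:R * Nu) * (energy l b * Num.sqrt (energy l b))).
Proof.
move=> ul lq bt; set F := modesum _ _ _ _ _ _; set V := energy l b.
have V0 : 0 <= V := energy_ge0 l b.
have T0 : 0 <= tau * q%:R * Nu by rewrite mulr_ge0 ?Nu_ge0 // mulr_ge0.
apply: (@le_trans _ _ (expect l (fun s' => `|F s' - expect l F s|) s)).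
  apply: expect_le => s'; rewrite ge_max normr_ge0 /=.
  apply: le_trans (ler_norm _); rewrite lerD2l lerN2.
  rewrite modesum_expect mulr_sumr; apply: ler_sum => k _; rewrite mulr1.
  by rewrite /V -(energy_mode b l w1 k); exact: expect_walk_4.
apply: (@le_trans _ _ (Num.sqrt (80 ^+ 2 * (tau * q%:R * Nu) * V ^+ 3))); last first.
  set r := leRHS; have r0 : 0 <= r.
    by apply: mulr_ge0 => //; do 2![apply: mulr_ge0; rewrite ?sqrtr_ge0 //].
  rewrite -(ger0_norm r0) -sqrtr_sqr ler_wsqrtr // /r !exprMn !sqr_sqrtr //.
  by rewrite [V ^+ 3]exprSr !mulrA.
apply: expect_norm_le.
apply: (@le_trans _ _ (2 * tau * q%:R * (3152 * V ^+ 3 * Nu))); last first.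
  have : 0 <= (tau * q%:R * Nu) * V ^+ 3 by rewrite mulr_ge0 // exprn_ge0.
  by lra.
apply: (@variance_bound R q w U b l tau _ prw w1 ul lq tau0 bt
  (fun k x => sqnorm x ^+ 2) (fun _ x => 20 * sqnorm x + 16 * V)
  (fun k x => (4 * sqnorm x)%:C * x) s _ (lexx _)).
  move=> k x y yV.
  rewrite sqnormB2 dotZl; have := dot_sqr_le x y; have := sqnorm_ge0 x; have := sqnorm_ge0 y.
  move: yV; rewrite -/V.
  set X := sqnorm x; set Y := sqnorm y; set d := dot x y => YV Y0 X0 dXY.
  have -> : (X ^+ 2 - (X + 4 * Y - 4 * d) ^+ 2) / 2 - 4 * X * d =
    4 * (- (X * Y) - 2 * d ^+ 2 + 4 * (d * Y) - 2 * Y ^+ 2) by field.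
  have Xd : `|d * Y| <= (X * Y + Y ^+ 2) / 2.
    rewrite normrM (ger0_norm Y0).
    have : `|d| <= (X + Y) / 2.
      have XY0 : 0 <= (X + Y) / 2 by lra.
      rewrite -[leRHS](ger0_norm XY0) -!sqrtr_sqr ler_wsqrtr //.
      by apply: le_trans dXY _; have := sqr_ge0 (X - Y); lra.
    by move/(ler_wpM2r Y0); lra.
  have XY : 0 <= X * Y by rewrite mulr_ge0.
  have YY : Y ^+ 2 <= Y * V by rewrite expr2 ler_wpM2l.
  have d0 := sqr_ge0 d.
  move: Xd; rewrite !ler_norml => /andP[h1 h2]; apply/andP; split; lra.
move=> k; set W := walk l (mode w b k).
have eW : energy l (mode w b k) = V by exact: energy_mode.
have W4 := expect_walk_4 (mode w b k) s ul; have W6 := expect_walk_6 (mode w b k) s ul.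
rewrite eW in W4 W6.
apply: (@le_trans _ _ (expect l (fun s' => 16 * sqnorm (W s') ^+ 3 +
   ((V * 800) * sqnorm (W s') ^+ 2 + 512 * V ^+ 3)) s)).
  apply: expect_le => s' /=; rewrite sqnormZ -/V.
  have : V * (20 * sqnorm (W s') + 16 * V) ^+ 2 <= V * (800 * sqnorm (W s') ^+ 2 + 512 * V ^+ 2).
    by rewrite ler_wpM2l //; have := sqr_ge0 (20 * sqnorm (W s') - 16 * V); lra.
  by lra.
rewrite !expectD !expectZ expect_cst.
have : V * expect l (fun s' => sqnorm (W s') ^+ 2) s <= V * (3 * V ^+ 2).
  exact: ler_wpM2l.
by move: W6; rewrite -/W; lra.
Qed.

Definition moricz_cst : R := 6 * 20 ^+ 3 * 80.

Lemma moricz_cst_ge0 : 0 <= moricz_cst.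
Proof. by apply: mulr_ge0 => //; apply: mulr_ge0 => //; exact: exprn_ge0. Qed.

(** Induction by bisection.  Both halves have energy at most [V / 2], so their
bounds [V_i sqrt V_i] sum to at most [5/6 V sqrt V] after the weight [7/6] of
[sqnormD_sqr_le], and the bounds [V_i^2] to at most [7/12 V^2].  The slack
absorbs the fourth power of the separating prefix, given by
[excess_sqnorm2]. *)
Lemma excess_max4 l s : uniq l -> all (fun m => (m < q)%N) l ->
  (forall n, n \in l -> sqnorm (b n) <= tau) ->
  expect l (fun s' => Num.max 0 (\sum_(k < q | U k) max4 l (mode w b k) s'
          - 240 ^+ 2 * energy l b ^+ 2 * Nu)) s <=
  moricz_cst * (Num.sqrt (tau * q%:R * Nu) * (energy l b * Num.sqrt (energy l b))).
Proof.
rewrite /moricz_cst; have N0 := Nu_ge0.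
set rho := Num.sqrt (tau * q%:R * Nu).
have rho0 : 0 <= rho := sqrtr_ge0 _.
have [m] := ubnP (size l); elim: m l s => // m IH l s /ltnSE lm ul lq bt.
have [->|l0] := eqVneq l [::].
  rewrite energy_nil expr0n /= mulr0 mul0r subr0 mul0r !mulr0.
  rewrite ge_max lexx /= big1 // => k _.
  exact: max4_nil.
set V := energy l b.
have V0 : 0 <= V := energy_ge0 l b.
have Vhalf : 0 <= V / 2 <= V by apply/andP; split; lra.
have [l1 [n [l2 [lE V1h V2h]]]] := energy_split l0 Vhalf.
have {}V2h : energy l2 b <= V / 2 by move: V2h; rewrite -/V; lra.
pose l3 := rcons l1 n.
have lE3 : l = l3 ++ l2 by rewrite lE /l3 -cats1 -catA.
have sub1 : {subset l1 <= l} by move=> x xl; rewrite lE mem_cat xl.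
have sub2 : {subset l2 <= l} by move=> x xl; rewrite lE3 mem_cat xl orbT.
have sub3 : {subset l3 <= l} by move=> x xl; rewrite lE3 mem_cat xl.
have [u1 u2 u3] : [/\ uniq l1, uniq l2 & uniq l3].
  move: (ul); rewrite lE3 cat_uniq => /and3P[u3 _ u2].
  by split => //; move: u3; rewrite rcons_uniq => /andP[].
have q1 : all (fun m => (m < q)%N) l1 by apply/allP => x /sub1; move/allP: lq; apply.
have q2 : all (fun m => (m < q)%N) l2 by apply/allP => x /sub2; move/allP: lq; apply.
have q3 : all (fun m => (m < q)%N) l3 by apply/allP => x /sub3; move/allP: lq; apply.
have b1 (x : nat) : x \in l1 -> sqnorm (b x) <= tau by move/sub1; exact: bt.
have b2 (x : nat) : x \in l2 -> sqnorm (b x) <= tau by move/sub2; exact: bt.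
have b3 (x : nat) : x \in l3 -> sqnorm (b x) <= tau by move/sub3; exact: bt.
have s1 : (size l1 < m)%N.
  by apply: leq_trans lm; rewrite lE size_cat /= addnS ltnS leq_addr.
have s2 : (size l2 < m)%N.
  by apply: leq_trans lm; rewrite lE size_cat /= addnS ltnS leq_addl.
pose e1 s' := Num.max 0 (\sum_(k < q | U k) max4 l1 (mode w b k) s'
          - 240 ^+ 2 * energy l1 b ^+ 2 * Nu).
pose e2 s' := Num.max 0 (\sum_(k < q | U k) max4 l2 (mode w b k) s'
          - 240 ^+ 2 * energy l2 b ^+ 2 * Nu).
pose e3 s' := Num.max 0 (modesum q w U b l3 (fun k x => sqnorm x ^+ 2) s'
          - 3 * energy l3 b ^+ 2 * Nu).
have E1 := IH l1 s s1 u1 q1 b1; have E2 s' := IH l2 s' s2 u2 q2 b2.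
have E3 := excess_sqnorm2 s u3 q3 b3.
rewrite -/(e1 _) in E1; rewrite -/(e3 _) in E3.
move: E1 E2 E3 V1h V2h.
set V1 := energy l1 b; set V2 := energy l2 b; set V3 := energy l3 b.
move=> E1 E2 E3 V1h V2h.
have V10 : 0 <= V1 := energy_ge0 l1 b.
have V20 : 0 <= V2 := energy_ge0 l2 b.
have V30 : 0 <= V3 := energy_ge0 l3 b.
have V12 : V1 + V2 <= V.
  by rewrite /V lE energy_cat energy_cons -/V1 -/V2; have := sqnorm_ge0 (b n); lra.
have V3V : V3 <= V by rewrite /V lE3 energy_cat -/V3 -/V2; lra.
have F1 : expect l e1 s = expect l1 e1 s.
  rewrite lE expect_cat; apply: expect_eq_loc => s' _; apply: expect_loc => s'' h.
  rewrite /e1; congr (Num.max _ (_ - _)); apply: eq_bigr => k _; apply: eq_max4 => x xl.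
  apply: h; apply: contraL xl => xl; apply: contraL (ul) => xl1.
  rewrite lE cat_uniq negb_and; apply/orP; right; rewrite negb_and; apply/orP; left.
  by rewrite negbK; apply/hasP; exists x.
have F2 : expect l e2 s <= 6 * 20 ^+ 3 * 80 * (rho * (V2 * Num.sqrt V2)).
  rewrite lE3 expect_cat -[leRHS](expect_cst l3 _ s); apply: expect_le => s'; exact: E2.
have F3 : expect l e3 s = expect l3 e3 s.
  rewrite lE3 expect_cat; apply: expect_eq_loc => s' _; apply: expect_loc => s'' h.
  rewrite /e3 !modesumE; congr (Num.max _ (_ - _)); apply: eq_bigr => k _.
  congr (sqnorm _ ^+ 2); apply: eq_walk => x xl.
  apply: h; apply: contraL xl => xl; apply: contraL (ul) => xl1.
  rewrite lE3 cat_uniq negb_and; apply/orP; right; rewrite negb_and; apply/orP; left.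
  by rewrite negbK; apply/hasP; exists x.
have sq : V1 ^+ 2 + 7 / 6 * V2 ^+ 2 <= 7 / 12 * V ^+ 2.
  have h1 : V1 * V1 <= V1 * (V / 2) by rewrite ler_wpM2l.
  have h2 : V2 * V2 <= V2 * (V / 2) by rewrite ler_wpM2l.
  have h3 : (V1 + V2) * V <= V * V by rewrite ler_wpM2r.
  have h4 : 0 <= V1 * V by rewrite mulr_ge0.
  by lra.
have sq3 : V3 ^+ 2 <= V ^+ 2 by rewrite lerXn2r ?nnegrE.
have NN : (240 ^+ 2 * V1 ^+ 2 + 7 / 6 * (240 ^+ 2 * V2 ^+ 2) + 20 ^+ 3 * (3 * V3 ^+ 2)) * Nu
     <= 240 ^+ 2 * V ^+ 2 * Nu.
  by rewrite ler_wpM2r //; lra.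
have srt (W : R) : 0 <= W -> W <= V / 2 -> W * Num.sqrt W <= W * (5 / 7 * Num.sqrt V).
  move=> W0 WV; rewrite ler_wpM2l //.
  rewrite -[5/7]ger0_norm ?divr_ge0 // -sqrtr_sqr -sqrtrM ?sqr_ge0 //.
  by apply: ler_wsqrtr; lra.
have sV0 : 0 <= Num.sqrt V := sqrtr_ge0 _.
apply: (@le_trans _ _ (expect l (fun s' => e1 s' + ((7 / 6) * e2 s' + 20 ^+ 3 * e3 s')) s)).
  apply: expect_le => s'.
  have h1 : 0 <= e1 s' by rewrite le_max lexx.
  have h2 : 0 <= e2 s' by rewrite le_max lexx.
  have h3 : 0 <= e3 s' by rewrite le_max lexx.
  rewrite ge_max; apply/andP; split; first lra.
  have g1 : \sum_(k < q | U k) max4 l1 (mode w b k) s'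
          - 240 ^+ 2 * V1 ^+ 2 * Nu <= e1 s' by rewrite le_max lexx orbT.
  have g2 : \sum_(k < q | U k) max4 l2 (mode w b k) s'
          - 240 ^+ 2 * V2 ^+ 2 * Nu <= e2 s' by rewrite le_max lexx orbT.
  have g3 : modesum q w U b l3 (fun k x => sqnorm x ^+ 2) s' - 3 * V3 ^+ 2 * Nu
     <= e3 s' by rewrite le_max lexx orbT.
  have : \sum_(k < q | U k) max4 l (mode w b k) s' <=
    \sum_(k < q | U k) max4 l1 (mode w b k) s' +
    (7 / 6 * (\sum_(k < q | U k) max4 l2 (mode w b k) s') +
     20 ^+ 3 * modesum q w U b l3 (fun k x => sqnorm x ^+ 2) s').
    rewrite modesumE !mulr_sumr -!big_split /=; apply: ler_sum => k _.
    by rewrite lE; exact: max4_split.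
  by lra.
rewrite !expectD !expectZ F1 F3.
have T1 : 6 * 20 ^+ 3 * 80 * (rho * (V1 * Num.sqrt V1)) <= 6 * 20 ^+ 3 * 80 * (rho * (V1 * (5 / 7 * Num.sqrt V))).
  by rewrite ler_wpM2l // ler_wpM2l // srt.
have T2 : 6 * 20 ^+ 3 * 80 * (rho * (V2 * Num.sqrt V2)) <= 6 * 20 ^+ 3 * 80 * (rho * (V2 * (5 / 7 * Num.sqrt V))).
  by rewrite ler_wpM2l // ler_wpM2l // srt.
have T3 : rho * (V3 * Num.sqrt V3) <= rho * (V * Num.sqrt V).
  by rewrite ler_wpM2l // ler_pM ?sqrtr_ge0 // ler_wsqrtr.
have T4 : (rho * Num.sqrt V) * (V1 + V2) <= (rho * Num.sqrt V) * V.
  by rewrite ler_wpM2l // mulr_ge0.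
have T5 : 0 <= (rho * Num.sqrt V) * V1 by rewrite !mulr_ge0.
move: E1 F2 E3; rewrite -/rho.
set a1 := expect l1 e1 s; set a2 := expect l e2 s; set a3 := expect l3 e3 s.
by move=> g1 g2 g3; lra.
Qed.

End Concentration.
End Moricz.

(** * Many good points in one block *)

Section Block.
Variable R : realType.
Implicit Types (x y z w : R[i]) (b c : nat -> R[i]) (s : nat -> bool) (l : seq nat).

Lemma norm_le_sqr (a c : R) : 0 <= c -> a ^+ 2 <= c ^+ 2 -> `|a| <= c.
Proof. by move=> c0 ac; rewrite -sqrtr_sqr -(ger0_norm c0) -sqrtr_sqr ler_wsqrtr. Qed.

Lemma dot_sqrE (x y : R[i]) :
  dot x y ^+ 2 = (sqnorm x * sqnorm y + complex.Re ((x^* * y) ^+ 2)) / 2.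
Proof. by case: x => ? ?; case: y => ? ?; rewrite /dot /sqnorm expr2 /=; field. Qed.

Local Opaque max4 walk sqnorm dot energy modesum.

(** A polynomial of degree four below twice an indicator.  Its mean can be computed
from moments and is positive when [x] is centred with small variance and
[M] is of the order of the square of that variance, hence the indicator has
positive mean for small [d]. *)
Lemma quartic_le_indicator (x M d : R) : x ^+ 4 <= M -> 0 < d <= 1 ->
  - x + x ^+ 2 - M - 2 * d <= 2 * ((x <= - d) && (M <= 16))%:R.
Proof.
move=> xM /andP[d0 d1].
have h1 := sqr_ge0 (x + 1).
have x20 := sqr_ge0 x.
have [xd|xd] /= := leP x (- d).
- have [M16|M16] /= := leP M 16; last first.
    rewrite mulr0; have [x2|x2] := leP (x ^+ 2) 4; last first.
      have : 4 * x ^+ 2 <= x ^+ 2 * x ^+ 2 by rewrite ler_wpM2r // ltW.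
      by have := sqr_ge0 (x + 1); lra.
    by lra.
  have h2 := sqr_ge0 (x ^+ 2 - 3 / 4).
  by rewrite mulr1; lra.
- rewrite mulr0; have [x0|x0] := leP 0 x.
    have [x1|x1] := leP x 1.
      have : x * x <= x * 1 by rewrite ler_wpM2l.
      have := sqr_ge0 (x ^+ 2); lra.
    have : x ^+ 2 * 1 <= x ^+ 2 * x ^+ 2.
      by rewrite ler_wpM2l // expr_ge1 // ltW.
    by lra.
  have : x * x <= d * d.
    by rewrite -mulrNN ler_pM // ?oppr_ge0 ?ltW //; lra.
  have : d * d <= d * 1 by rewrite ler_wpM2l // ltW.
  have := sqr_ge0 (x ^+ 2); lra.
Qed.

Local Opaque moricz_cst.

Section Good.
Variables (q : nat) (w : R[i]) (U : pred nat) (b : nat -> R[i]) (l : seq nat).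
Variables (tau : R) (u : nat -> R[i]).
Hypotheses (prw : q.-primitive_root w) (w1 : sqnorm w = 1) (tau0 : 0 <= tau).
Hypotheses (ul : uniq l) (lq : all (fun m => (m.*2 < q)%N) l).
Hypotheses (bt : forall n, n \in l -> sqnorm (b n) <= tau) (u1 : forall k, sqnorm (u k) = 1).
Variable sc : R.
Hypotheses (sc0 : 0 < sc) (sc1 : sc <= 1) (scK : sc ^+ 2 * 240 ^+ 2 = 1 / 4).
Local Notation Nu := (\sum_(k < q | U k) (1 : R)).
Local Notation V := (energy l b).

(** On average over the directions the square of a component is half the squared
norm; the deviation is a Fourier coefficient at frequency [2 n], small after
averaging over [U] by Bessel.  Doubling the frequencies is the reason for
[m.*2 < q]. *)
Lemma mean_dot2_ge s :
  V * Nu / 2 - Num.sqrt (tau * q%:R * Nu) * Num.sqrt V / 2 <=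
  expect l (modesum q w U b l (fun k x => dot (u k) x ^+ 2)) s.
Proof.
pose T n : R[i] := \sum_(k < q | U k) ((u k)^* ^+ 2) * (w ^+ k) ^+ n.*2.
have E : expect l (modesum q w U b l (fun k x => dot (u k) x ^+ 2)) s =
    V * Nu / 2 + (\sum_(n <- l) complex.Re (b n ^+ 2 * T n)) / 2.
  rewrite modesum_expect (eq_bigr (fun k : 'I_q => V / 2 +
      \sum_(n <- l) complex.Re (b n ^+ 2 * ((u k)^* ^+ 2 * (w ^+ k) ^+ n.*2)) / 2)).
    rewrite big_split /=; congr (_ + _).
      by rewrite mulr_sumr mulr_suml; apply: eq_bigr => k _; rewrite mulr1.
    rewrite exchange_big mulr_suml; apply: eq_bigr => n _.
    by rewrite /T mulr_sumr Re_sum mulr_suml.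
  move=> k _; rewrite expect_walk_dot2 // mulr_suml -big_split; apply: eq_bigr => n _.
  rewrite dot_sqrE u1 sqnorm_mode // mul1r mulrDl; congr (_ + complex.Re _ / 2).
  by rewrite /mode -mul2n mulnC exprM; ring.
rewrite E lerD2l -mulNr ler_wpM2r //.
suff : `|\sum_(n <- l) complex.Re (b n ^+ 2 * T n)| <=
    Num.sqrt (tau * q%:R * Nu) * Num.sqrt V.
  by rewrite ler_norml => /andP[].
have N0 : 0 <= Nu := Nu_ge0 R q U.
have V0 : 0 <= V := energy_ge0 l b.
apply: (@le_trans _ _ (\sum_(n <- l)
    Num.sqrt (sqnorm (b n)) * Num.sqrt (sqnorm (b n) * sqnorm (T n)))).
  apply: le_trans (ler_norm_sum _ _ _) _; apply: ler_sum => n _.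
  apply: norm_le_sqr; first by rewrite mulr_ge0 ?sqrtr_ge0.
  rewrite exprMn !sqr_sqrtr ?mulr_ge0 ?sqnorm_ge0 //.
  apply: le_trans (sqr_Re_le _) _; rewrite sqnormM sqnormX expr2 mulrA; exact: lexx.
apply: le_trans (ler_norm _) _; apply: norm_le_sqr; first by rewrite mulr_ge0 ?sqrtr_ge0.
apply: le_trans (cauchy_schwarz_sum _ _ _ _) _.
rewrite exprMn [leRHS]mulrC !sqr_sqrtr ?mulr_ge0 //.
under eq_bigr do rewrite sqr_sqrtr ?sqnorm_ge0 //.
rewrite -/V ler_wpM2l //.
apply: (@le_trans _ _ (tau * \sum_(n <- l) sqnorm (T n))).
  rewrite mulr_sumr !big_seq; apply: ler_sum => n nl.
  by rewrite sqr_sqrtr ?mulr_ge0 ?sqnorm_ge0 // ler_wpM2r ?sqnorm_ge0 ?bt.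
rewrite -mulrA ler_wpM2l //.
have -> : Nu = \sum_(k < q | U k) sqnorm ((u k)^* ^+ 2).
  by apply: eq_bigr => k _; rewrite sqnormX sqnormJ u1 expr1n.
rewrite -(big_map double xpredT (fun m => sqnorm (\sum_(k < q | U k) (u k)^* ^+ 2 * (w ^+ k) ^+ m))).
apply: (bessel U (fun k => (u k)^* ^+ 2) prw w1); last by rewrite all_map.
by rewrite map_inj_uniq // => i j; exact: double_inj.
Qed.

(** The factor [sc / 16] is the rate of descent and [2 / sc] the size allowed to the
maximal partial sum, both in units of the standard deviation. *)
Definition good s (k : nat) : bool :=
  (dot (u k) (walk l (mode w b k) s) <= - (sc / 16) * Num.sqrt V) &&
  (max4 l (mode w b k) s <= (2 / sc * Num.sqrt V) ^+ 4).

Definition block_cst : R := 16 / sc ^+ 2 *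
  (2 * sc + 5 * sc ^+ 2 + sc ^+ 4 * moricz_cst R).

Lemma block_cst_ge0 : 0 <= block_cst.
Proof.
apply: mulr_ge0; first by rewrite divr_ge0 ?sqr_ge0.
apply: addr_ge0; last exact: mulr_ge0 (exprn_ge0 _ (ltW sc0)) (moricz_cst_ge0 R).
apply: addr_ge0; first exact: mulr_ge0 (ler0n _ _) (ltW sc0).
exact: mulr_ge0 (ler0n _ _) (sqr_ge0 _).
Qed.

(** Summing [quartic_le_indicator] over [U] with [x = sc * dot u X / sigma] bounds
the number of good points from below by averages of the first, second and fourth
order.  These are close to their means by [mean_dot], [mean_dot2] and
[excess_max4]; the normalisation of [sc] makes the second-order term win over
the quartic one by [sc ^+ 2 / 4].  Markov's inequality turns the closeness
into a probability. *)
Lemma prob_few_good s : 0 < V -> 0 < Nu ->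
  expect l (fun s' => (\sum_(k < q | U k && good s' k) (1 : R) < sc ^+ 2 / 32 * Nu)%R%:R) s
  <= block_cst * (Num.sqrt (tau * q%:R * Nu) / (Num.sqrt V * Nu)).
Proof.
move=> V0 N0.
have sc20 : 0 <= sc ^+ 2 := sqr_ge0 _.
have sc2p : 0 < sc ^+ 2 by rewrite exprn_gt0.
have sc4p : 0 < sc ^+ 4 by rewrite exprn_gt0.
set sV := Num.sqrt V; have sV0 : 0 < sV by rewrite sqrtr_gt0.
have sVV : sV ^+ 2 = V by rewrite sqr_sqrtr // ltW.
set rho := Num.sqrt (tau * q%:R * Nu).
have rho0 : 0 <= rho := sqrtr_ge0 _.
have lq' : all (fun m => (m < q)%N) l.
  apply: sub_all lq => m; apply: leq_ltn_trans; rewrite -addnn; exact: leq_addr.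
set K1 := moricz_cst R.
pose A1 s' := modesum q w U b l (fun k x => dot (u k) x) s'.
pose A2 s' := modesum q w U b l (fun k x => dot (u k) x ^+ 2) s'.
pose G s' := \sum_(k < q | U k) max4 l (mode w b k) s'.
pose ex s' := Num.max 0 (G s' - 240 ^+ 2 * V ^+ 2 * Nu).
pose err s' := (sc / sV) * `|A1 s'| + ((sc ^+ 2 / V) * `|A2 s' - expect l A2 s| +
   ((sc ^+ 4 / V ^+ 2) * ex s' + sc ^+ 2 / 2 * (rho / sV))).
have Eerr : expect l err s <=
   (2 * sc + 5 * sc ^+ 2 + sc ^+ 4 * K1) * (rho / sV).
  rewrite /err !expectD !expectZ expect_cst.
  have h1 := @mean_dot R q w U b tau prw w1 tau0 l u s ul lq' bt u1.
  have h2 := @mean_dot2 R q w U b tau prw w1 tau0 l u s ul lq' bt u1.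
  have h3 := @excess_max4 R q w U b tau prw w1 tau0 l s ul lq' bt.
  rewrite -/A1 in h1; rewrite -/A2 in h2.
  have e1 : sc / sV * expect l (fun s' => `|A1 s'|) s <= 2 * sc * (rho / sV).
    rewrite (_ : 2 * sc * (rho / sV) = sc / sV * (2 * rho)); last by ring.
    apply: ler_wpM2l; first by rewrite divr_ge0 ?ltW.
    apply: le_trans h1 _; rewrite sqrtrM // ler_wpM2r //.
    by rewrite -[leRHS]ger0_norm // -sqrtr_sqr ler_wsqrtr //; lra.
  have e2 : sc ^+ 2 / V * expect l (fun s' => `|A2 s' - expect l A2 s|) s <=
      4 * sc ^+ 2 * (rho / sV).
    rewrite (_ : 4 * sc ^+ 2 * (rho / sV) = sc ^+ 2 / V * (4 * sV * rho)); last first.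
      by rewrite -sVV; field; rewrite gt_eqF.
    apply: ler_wpM2l; first by rewrite divr_ge0 ?sqr_ge0 ?ltW.
    have V00 := ltW V0.
    apply: le_trans h2 _; rewrite sqrtrM; last exact: mulr_ge0.
    apply: ler_wpM2r => //; rewrite sqrtrM //; apply: ler_wpM2r; first exact: ltW.
    by rewrite -[leRHS]ger0_norm // -sqrtr_sqr ler_wsqrtr //; lra.
  have e3 : sc ^+ 4 / V ^+ 2 * expect l ex s <= sc ^+ 4 * K1 * (rho / sV).
    rewrite (_ : sc ^+ 4 * K1 * (rho / sV) = sc ^+ 4 / V ^+ 2 * (K1 * (rho * (V * sV)))).
      apply: ler_wpM2l; first by rewrite divr_ge0 ?exprn_ge0 ?ltW.
      exact: h3.
    by rewrite -sVV; field; rewrite gt_eqF.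
  have := mulr_ge0 (sqr_ge0 sc) (divr_ge0 rho0 (ltW sV0)).
  move: e1 e2 e3; lra.
apply: (@le_trans _ _ (expect l err s / (sc ^+ 2 / 16 * Nu))); last first.
  rewrite ler_pdivrMr ?mulr_gt0 ?divr_gt0 ?exprn_gt0 //; apply: le_trans Eerr _.
  rewrite le_eqVlt; apply/orP; left; apply/eqP; rewrite /block_cst -/K1.
  by field; rewrite !gt_eqF.
apply: expect_markov; first by rewrite mulr_gt0 ?divr_gt0 ?exprn_gt0.
  move=> s' _; apply: addr_ge0; last (apply: addr_ge0; last apply: addr_ge0).
  - exact: mulr_ge0 (divr_ge0 (ltW sc0) (ltW sV0)) (normr_ge0 _).
  - exact: mulr_ge0 (divr_ge0 sc20 (ltW V0)) (normr_ge0 _).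
  - by apply: mulr_ge0 (divr_ge0 (ltW sc4p) (sqr_ge0 _)) _; rewrite le_max lexx.
  - exact: mulr_ge0 (divr_ge0 sc20 (ler0n _ _)) (divr_ge0 rho0 (ltW sV0)).
move=> s' _ few.
have sum_le : \sum_(k < q | U k) (- (sc / sV) * dot (u k) (walk l (mode w b k) s') +
   (sc ^+ 2 / V * dot (u k) (walk l (mode w b k) s') ^+ 2 +
   (- (sc ^+ 4 / V ^+ 2) * max4 l (mode w b k) s' - 2 * (sc ^+ 2 / 16)))) <=
   2 * \sum_(k < q | U k && good s' k) 1.
  rewrite big_mkcondr /= mulr_sumr; apply: ler_sum => k _.
  set d := dot _ _; set m := max4 _ _ _.
  have dm : (sc / sV * d) ^+ 4 <= sc ^+ 4 / V ^+ 2 * m.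
    rewrite (_ : (sc / sV * d) ^+ 4 = sc ^+ 4 / V ^+ 2 * d ^+ 4); last first.
      by rewrite -sVV; field; rewrite gt_eqF.
    apply: ler_wpM2l; first by rewrite divr_ge0 ?exprn_ge0 ?ltW.
    apply: le_trans (prefix_le_max4 l (mode w b k) s' (size l)); rewrite take_size.
    rewrite (exprM d 2 2) lerXn2r ?nnegrE ?sqr_ge0 ?sqnorm_ge0 //.
    by apply: le_trans (dot_sqr_le _ _) _; rewrite u1 mul1r.
  have dd : 0 < sc ^+ 2 / 16 <= 1.
    rewrite divr_gt0 ?exprn_gt0 //=; have : sc ^+ 2 <= 1 by apply: exprn_ile1 => //; exact: ltW.
    by lra.
  have := quartic_le_indicator dm dd.
  have -> : (sc / sV * d <= - (sc ^+ 2 / 16)) && (sc ^+ 4 / V ^+ 2 * m <= 16) = good s' k.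
    rewrite /good -/d -/m -/sV; congr (_ && _).
      rewrite -(ler_pM2l (x := sV / sc)) ?divr_gt0 //.
      by congr (_ <= _); field; rewrite !gt_eqF.
    rewrite -(ler_pM2l (x := V ^+ 2 / sc ^+ 4)) ?divr_gt0 ?exprn_gt0 //.
    by congr (_ <= _); rewrite -?sVV; field; rewrite !gt_eqF.
  have -> : 2 * (if good s' k then 1 else 0) = 2 * (good s' k)%:R :> R by case: good.
  apply: le_trans; rewrite le_eqVlt; apply/orP; left; apply/eqP.
  by rewrite -sVV; field; rewrite gt_eqF.
have gE : \sum_(k < q | U k) (- (sc / sV) * dot (u k) (walk l (mode w b k) s') +
   (sc ^+ 2 / V * dot (u k) (walk l (mode w b k) s') ^+ 2 +
   (- (sc ^+ 4 / V ^+ 2) * max4 l (mode w b k) s' - 2 * (sc ^+ 2 / 16)))) =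
   - (sc / sV) * A1 s' + (sc ^+ 2 / V * A2 s' +
    (- (sc ^+ 4 / V ^+ 2) * G s' - 2 * (sc ^+ 2 / 16) * Nu)).
  rewrite /A1 /A2 !modesumE /G !mulr_sumr -sumrB -!big_split /=.
  by apply: eq_bigr => k _; rewrite mulr1.
rewrite gE in sum_le.
have a1 : - (sc / sV * `|A1 s'|) <= - (sc / sV) * A1 s'.
  rewrite mulNr lerN2; apply: ler_wpM2l; first by rewrite divr_ge0 ?ltW.
  exact: ler_norm.
have V00 := ltW V0.
have a2 : sc ^+ 2 / V * (expect l A2 s - `|A2 s' - expect l A2 s|) <= sc ^+ 2 / V * A2 s'.
  apply: ler_wpM2l; first exact: divr_ge0 sc20 V00.
  by have := ler_norm (- (A2 s' - expect l A2 s)); rewrite normrN; lra.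
have a3 : sc ^+ 2 / V * (V * Nu / 2 - rho * sV / 2) <= sc ^+ 2 / V * expect l A2 s.
  by apply: ler_wpM2l; [exact: divr_ge0 sc20 V00|exact: mean_dot2_ge].
have a3E : sc ^+ 2 / V * (V * Nu / 2 - rho * sV / 2) =
    sc ^+ 2 / 2 * Nu - sc ^+ 2 / 2 * (rho / sV).
  by rewrite -sVV; field; rewrite gt_eqF.
have a4 : sc ^+ 4 / V ^+ 2 * G s' <=
   sc ^+ 4 / V ^+ 2 * (ex s' + 240 ^+ 2 * V ^+ 2 * Nu).
  apply: ler_wpM2l; first exact: divr_ge0 (ltW sc4p) (sqr_ge0 _).
  by rewrite -lerBlDr le_max lexx orbT.
have a4E : sc ^+ 4 / V ^+ 2 * (240 ^+ 2 * V ^+ 2 * Nu) = sc ^+ 2 / 4 * Nu.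
  rewrite (_ : _ * (_ * _ * _) = sc ^+ 2 * (sc ^+ 2 * 240 ^+ 2) * Nu); last first.
    by field; rewrite gt_eqF.
  by rewrite scK; field.
rewrite mulrDr a4E in a4; rewrite a3E in a3; rewrite mulrBr in a2.
rewrite /err; move: few a1 a2 a3 a4 sum_le.
move: (sc / sV * `|A1 s'|) (- (sc / sV) * A1 s') (sc ^+ 2 / V * expect l A2 s).
move: (sc ^+ 2 / V * `|A2 s' - expect l A2 s|) (sc ^+ 2 / V * A2 s').
move: (sc ^+ 4 / V ^+ 2 * ex s') (\sum_(k < q | U k && good s' k) 1) => e3 cnt e2 x2 e1 x1 y2.
rewrite mulNr; move: (sc ^+ 4 / V ^+ 2 * G s') (rho / sV) => x4 r.
move: N0; move: (\sum_(k < q | U k) 1) => N N0 few a1 a2 a3 a4 sum_le.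
by move: (sc ^+ 2) sc20 few a1 a2 a3 a4 sum_le => z; lra.
Qed.

End Good.
End Block.

(** * Trigonometric sums at neighbouring angles *)

Section Circle.
Variable R : realType.
Implicit Types (x y z w : R[i]) (b c : nat -> R[i]) (s : nat -> bool) (l : seq nat).

(** The modulus as a real number; the norm of [R[i]] takes values in [R[i]]. *)
Definition cnorm x : R := Num.sqrt (sqnorm x).

Lemma normC_cnorm x : `|x| = (cnorm x)%:C.
Proof. exact: normc_def. Qed.

Lemma cnorm_ge0 x : 0 <= cnorm x. Proof. exact: sqrtr_ge0. Qed.

Lemma cnorm_sqr x : cnorm x ^+ 2 = sqnorm x.
Proof. by rewrite sqr_sqrtr ?sqnorm_ge0. Qed.

Lemma cnorm0 : cnorm 0 = 0. Proof. by rewrite /cnorm sqnorm0 sqrtr0. Qed.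

Lemma cnormD x y : cnorm (x + y) <= cnorm x + cnorm y.
Proof. by rewrite -lecR rmorphD /= -!normC_cnorm ler_normD. Qed.

Lemma cnormM x y : cnorm (x * y) = cnorm x * cnorm y.
Proof. by rewrite /cnorm sqnormM sqrtrM ?sqnorm_ge0. Qed.

Lemma cnormN x : cnorm (- x) = cnorm x.
Proof. by apply: (@complexI R); rewrite -!normC_cnorm normrN. Qed.

Lemma cnormB x y : cnorm (x - y) <= cnorm x + cnorm y.
Proof. by rewrite -(cnormN y) cnormD. Qed.

Lemma cnorm_sum (I : Type) (r : seq I) (P : pred I) (F : I -> R[i]) :
  cnorm (\sum_(i <- r | P i) F i) <= \sum_(i <- r | P i) cnorm (F i).
Proof.
elim/big_ind2: _ => [|x1 x2 y1 y2 h1 h2|//]; first by rewrite cnorm0.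
exact: le_trans (cnormD _ _) (lerD h1 h2).
Qed.

Lemma cnorm_le x (B : R) : 0 <= B -> sqnorm x <= B ^+ 2 -> cnorm x <= B.
Proof. by move=> B0 xB; rewrite -(ger0_norm B0) -sqrtr_sqr ler_wsqrtr. Qed.

Lemma sqnorm_le x (B : R) : cnorm x <= B -> sqnorm x <= B ^+ 2.
Proof.
move=> xB; rewrite -cnorm_sqr lerXn2r ?nnegrE ?cnorm_ge0 //.
exact: le_trans (cnorm_ge0 _) xB.
Qed.

Definition cis (t : R) : R[i] := cos t +i* sin t.

Lemma cisD t t' : cis (t + t') = cis t * cis t'.
Proof.
by apply/eqP; rewrite eq_complex /= cosD sinD eqxx /=; apply/eqP; ring.
Qed.

Lemma cis0 : cis 0 = 1.
Proof. by rewrite /cis cos0 sin0. Qed.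

Lemma sqnorm_cis t : sqnorm (cis t) = 1.
Proof. exact: cos2Dsin2. Qed.

Lemma cnorm_cis t : cnorm (cis t) = 1.
Proof. by rewrite /cnorm sqnorm_cis sqrtr1. Qed.

Lemma cisX t n : cis t ^+ n = cis (n%:R * t).
Proof.
elim: n => [|n IH]; first by rewrite expr0 mul0r cis0.
by rewrite exprS IH -cisD -natr1 mulrDl mul1r addrC.
Qed.

Lemma sin_le (t : R) : 0 <= t -> `|sin t| <= t.
Proof.
move=> t0.
have dsin (x : R) : x \in `]0, t[ -> is_derive x 1 (@sin R) (cos x).
  by move=> _; exact: is_derive_sin.
have csin : {within `[0, t], continuous (@sin R)}.
  by apply: continuous_subspaceT; exact: continuous_sin.
have [c _] := MVT_segment t0 dsin csin.
rewrite sin0 !subr0 => ->; rewrite normrM (ger0_norm t0).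
by rewrite -[leRHS]mul1r ler_wpM2r // cos_max.
Qed.

(** The chord is shorter than the arc. *)
Lemma cis_sub1_le (t : R) : cnorm (cis t - 1) <= `|t|.
Proof.
apply: cnorm_le => //.
have -> : sqnorm (cis t - 1) = 4 * sin (t / 2) ^+ 2.
  have -> : cis t = cis (t / 2) ^+ 2 by rewrite cisX mulrC divfK.
  rewrite /cis /sqnorm expr2 /=; have := cos2Dsin2 (t / 2).
  move: (cos _) (sin _) => c e h.
  have {h} h : c ^+ 2 = 1 - e ^+ 2 by lra.
  have -> : (c * c - e * e - 1) ^+ 2 + (c * e + e * c - 0) ^+ 2 =
    (c ^+ 2 - e ^+ 2 - 1) ^+ 2 + 4 * c ^+ 2 * e ^+ 2 by ring.
  by rewrite h; ring.
have h : `|sin (t / 2)| <= `|t| / 2.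
  have [t0|t0] := leP 0 t.
    by rewrite (ger0_norm t0) sin_le // divr_ge0.
  rewrite -normrN -sinN (ltr0_norm t0) -mulNr sin_le // divr_ge0 //.
  by rewrite oppr_ge0 ltW.
have : `|sin (t / 2)| ^+ 2 <= (`|t| / 2) ^+ 2 by rewrite lerXn2r ?nnegrE ?divr_ge0.
by rewrite real_normK ?num_real //; lra.
Qed.

Lemma cis_prim q : (0 < q)%N -> q.-primitive_root (cis (2 * pi / q%:R)).
Proof.
move=> q0.
have q0r : 0 < q%:R :> R by rewrite ltr0n.
have w1 : cis (2 * pi / q%:R) ^+ q = 1.
  by rewrite cisX mulrC divfK ?gt_eqF // mulr_natl /cis cos2pi sin2pi.
have [m mprim mq] := prim_order_exists q0 w1.
suff mE : m = q by move: mprim; rewrite mE.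
apply/eqP; rewrite eqn_leq dvdn_leq //= leqNgt; apply/negP => ltmq.
have m0 := prim_order_gt0 mprim.
have := prim_expr_order mprim; rewrite cisX => /(congr1 (@complex.Re R)) /=.
set t := _ * _ => ct.
have t0 : 0 < t / 2 < pi.
  have -> : t / 2 = pi * (m%:R / q%:R) by rewrite /t; field; rewrite gt_eqF.
  rewrite mulr_gt0 ?pi_gt0 ?divr_gt0 ?ltr0n //=.
  by rewrite gtr_pMr ?pi_gt0 // ltr_pdivrMr // mul1r ltr_nat.
have := sin_gt0_pi t0.
have : cos t = 1 - 2 * sin (t / 2) ^+ 2.
  have -> : t = t / 2 + t / 2 by field.
  rewrite cosD -!expr2 (_ : (t / 2 + t / 2) / 2 = t / 2); last by field.
  by have := cos2Dsin2 (t / 2); lra.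
rewrite ct => h sp; have : 0 < sin (t / 2) ^+ 2 by rewrite exprn_gt0.
by lra.
Qed.

Lemma abel_sum (x g : nat -> R[i]) N M : (N <= M)%N ->
  \sum_(N <= n < M) x n * g n =
  (\sum_(N <= n < M) x n) * g M -
  \sum_(N <= m < M) (\sum_(N <= n < m.+1) x n) * (g m.+1 - g m).
Proof.
move=> /subnKC <-; elim: (M - N)%N => [|k IH].
  by rewrite addn0 !big_geq // mul0r subrr.
rewrite addnS !(big_nat_recr (N + k)%N) ?leq_addr //= IH.
by ring.
Qed.

(** Abel summation: the factors [cis (n t) - 1] have size and total variation at
most [M |t|]. *)
Lemma cnorm_twist_le (x : nat -> R[i]) N M (t B : R) : (N <= M)%N ->
  (forall m, (N <= m <= M)%N -> cnorm (\sum_(N <= n < m) x n) <= B) ->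
  cnorm (\sum_(N <= n < M) x n * (cis (n%:R * t) - 1)) <= 2 * M%:R * `|t| * B.
Proof.
move=> NM xB; rewrite abel_sum //.
have B0 : 0 <= B by apply: le_trans (cnorm_ge0 _) (xB M _); rewrite NM leqnn.
apply: le_trans (cnormB _ _) _.
have h1 : cnorm ((\sum_(N <= n < M) x n) * (cis (M%:R * t) - 1)) <= B * (M%:R * `|t|).
  rewrite cnormM ler_pM ?cnorm_ge0 // ?xB ?NM ?leqnn //.
  by apply: le_trans (cis_sub1_le _) _; rewrite normrM normr_nat.
have h2 : cnorm (\sum_(N <= m < M) (\sum_(N <= n < m.+1) x n) *
    (cis (m.+1%:R * t) - 1 - (cis (m%:R * t) - 1))) <= M%:R * (B * `|t|).
  apply: le_trans (cnorm_sum _ _ _) _.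
  apply: (@le_trans _ _ (\sum_(N <= m < M) B * `|t|)).
    rewrite !big_nat; apply: ler_sum => m /andP[Nm mM].
    rewrite cnormM ler_pM ?cnorm_ge0 // ?xB // ?mM ?leqW //.
    rewrite opprB addrA addrNK -natr1 mulrDl mul1r cisD.
    rewrite -[X in _ - X]mulr1 -mulrBr cnormM cnorm_cis mul1r; exact: cis_sub1_le.
  rewrite big_const_nat iter_addr_0 -[leLHS]mulr_natl ler_wpM2r ?mulr_ge0 //.
  by rewrite ler_nat leq_subr.
by apply: le_trans (lerD h1 h2) _; lra.
Qed.

Definition tsum (a : nat -> R[i]) N M (t : R) s : R[i] :=
  \sum_(N <= n < M) (rad R (s n))%:C * (a n * cis (n%:R * t)).

Lemma tsum_walk a N M t s :
  tsum a N M t s = walk (index_iota N M) (fun n => a n * cis (n%:R * t)) s.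
Proof. by []. Qed.

Lemma eq_tsum a N M t s s' : (forall n, (N <= n < M)%N -> s n = s' n) ->
  tsum a N M t s = tsum a N M t s'.
Proof. by move=> ss'; apply: eq_big_nat => n /ss' ->. Qed.

Lemma tsum_cat a N M L t s : (N <= M <= L)%N ->
  tsum a N L t s = tsum a N M t s + tsum a M L t s.
Proof. by move=> /andP[NM ML]; rewrite /tsum (big_cat_nat NM ML). Qed.

Lemma tsum_shift a N M t t' s :
  tsum a N M t' s - tsum a N M t s =
  \sum_(N <= n < M) ((rad R (s n))%:C * (a n * cis (n%:R * t))) *
     (cis (n%:R * (t' - t)) - 1).
Proof.
rewrite /tsum -sumrB; apply: eq_bigr => n _.
have -> : cis (n%:R * t') = cis (n%:R * t) * cis (n%:R * (t' - t)).
  by rewrite -cisD -mulrDr addrC subrK.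
ring.
Qed.

Lemma tsum_shift_le a N M t t' s (B : R) : (N <= M)%N ->
  (forall m, (N <= m <= M)%N -> cnorm (tsum a N m t s) <= B) ->
  cnorm (tsum a N M t' s - tsum a N M t s) <= 2 * M%:R * `|t' - t| * B.
Proof. by move=> NM tB; rewrite tsum_shift; exact: cnorm_twist_le. Qed.

(** Control of all partial sums at one angle gives control at nearby angles, so
only grid angles have to be examined. *)
Lemma tsum_near_le a N M t t' s (B D : R) :
  (forall m, (N <= m <= M)%N -> cnorm (tsum a N m t s) <= B) ->
  2 * M%:R * `|t' - t| <= D ->
  forall m, (N <= m <= M)%N -> cnorm (tsum a N m t' s) <= (1 + D) * B.
Proof.
move=> tB tD m /andP[Nm mM].
rewrite -[tsum a N m t' s](subrK (tsum a N m t s)).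
have B0 : 0 <= B by apply: le_trans (cnorm_ge0 _) (tB m _); rewrite Nm.
apply: le_trans (cnormD _ _) _; rewrite mulrDl mul1r addrC lerD ?tB ?Nm //.
apply: (@le_trans _ _ (2 * m%:R * `|t' - t| * B)).
  apply: tsum_shift_le => // m' /andP[Nm' m'm]; apply: tB.
  by rewrite Nm' (leq_trans m'm).
rewrite ler_wpM2r // (le_trans _ tD) // ler_wpM2r // ler_wpM2l // ler_nat //.
Qed.

Definition dir x : R[i] := if x == 0 then 1 else ((cnorm x)^-1)%:C * x.

Lemma cnorm_eq0 x : (cnorm x == 0) = (x == 0).
Proof.
by rewrite -[x == 0]normr_eq0 normC_cnorm -(inj_eq (@complexI R)).
Qed.

Lemma sqnorm_dir x : sqnorm (dir x) = 1.
Proof.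
rewrite /dir; case: eqP => [_|/eqP x0]; first exact: sqnorm1.
by rewrite sqnormZ -cnorm_sqr -exprMn mulVf ?expr1n // cnorm_eq0.
Qed.

Lemma dot_dir x y : cnorm x * dot (dir x) y = dot x y.
Proof.
rewrite /dir; case: eqP => [->|/eqP x0]; first by rewrite cnorm0 /dot /= !mul0r addr0.
by rewrite dotZl mulrA divff ?mul1r // cnorm_eq0.
Qed.

(** Far from the origin the linear gain [-2 c sg |x|] beats the quadratic loss
[C^2 sg^2]; close to it the triangle inequality is enough. *)
Lemma steer_le x y (c C sg r : R) : 0 < c -> 0 < C -> 0 < sg ->
  dot (dir x) y <= - c * sg -> cnorm y <= C * sg -> cnorm x <= r ->
  cnorm (x + y) <= Num.max (r - c * sg / 2) ((C ^+ 2 / c + C) * sg).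
Proof.
move=> c0 C0 sg0 xy yC xr; rewrite le_max; apply/orP.
have x0 := cnorm_ge0 x; have y0 := cnorm_ge0 y.
have [big|small] := leP (C ^+ 2 / c * sg) (cnorm x); [left|right].
  apply: (@le_trans _ _ (cnorm x - c * sg / 2)); last by rewrite lerD2r.
  have C2 : C ^+ 2 * sg <= c * cnorm x.
    by move: big; rewrite mulrAC ler_pdivrMr // [cnorm x * c]mulrC.
  have c2 : c * (c * sg) <= c * (C * sg).
    rewrite ler_wpM2l ?(ltW c0) //; apply: le_trans yC.
    apply: (@le_trans _ _ (- dot (dir x) y)); first by move: xy; lra.
    apply: le_trans (ler_norm _) _; rewrite normrN.
    apply: norm_le_sqr => //; rewrite cnorm_sqr.
    by apply: le_trans (dot_sqr_le _ _) _; rewrite sqnorm_dir mul1r.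
  have cC : c <= C by move: c2; rewrite ler_pM2l // ler_pM2r.
  apply: cnorm_le.
    have : c * (c * sg) <= c * cnorm x.
      apply: le_trans C2; rewrite mulrA ler_wpM2r ?(ltW sg0) // -expr2.
      by rewrite lerXn2r ?nnegrE ?(ltW c0) ?(ltW C0).
    by rewrite ler_pM2l //; have := mulr_gt0 c0 sg0; lra.
  rewrite sqnormD -(dot_dir x) -!cnorm_sqr.
  have h1 : cnorm x * dot (dir x) y <= cnorm x * (- c * sg) by rewrite ler_wpM2l.
  have h2 : cnorm y ^+ 2 <= (C * sg) ^+ 2 by rewrite lerXn2r ?nnegrE // mulr_ge0 ?(ltW C0) ?(ltW sg0).
  have h3 : sg * (C ^+ 2 * sg) <= sg * (c * cnorm x) by rewrite ler_wpM2l // ltW.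
  have := sqr_ge0 (c * sg); lra.
by apply: le_trans (cnormD _ _) _; move: small yC; rewrite mulrDl; lra.
Qed.

End Circle.

(** * The tree of alive angles *)

Section Tree.
Variable R : realType.
Implicit Types (x y z w : R[i]) (b : nat -> R[i]) (s : nat -> bool) (l : seq nat).

Lemma pi_lt4 : (pi : R) < 4.
Proof. by have := @pihalf_lt2 R; lra. Qed.

Lemma max4_tsum_le (a : nat -> R[i]) N M t s (B : R) : 0 <= B ->
  max4 (index_iota N M) (fun n => a n * cis (n%:R * t)) s <= B ^+ 4 ->
  forall m, (N <= m <= M)%N -> cnorm (tsum a N m t s) <= B.
Proof.
move=> B0 mB m /andP[Nm mM]; apply: cnorm_le => //.
rewrite -[leLHS]ger0_norm ?sqnorm_ge0 //; apply: norm_le_sqr; first exact: sqr_ge0.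
rewrite -exprM; apply: le_trans mB.
have -> : tsum a N m t s =
    walk (take (m - N)%N (index_iota N M)) (fun n => a n * cis (n%:R * t)) s.
  by rewrite tsum_walk /index_iota take_iota (minn_idPl _) // leq_sub2r.
exact: prefix_le_max4.
Qed.

Variables (a : nat -> R[i]) (Nn rho : nat -> nat) (A : nat).
Variables (delta r : nat -> R) (c C kap : R).

Definition grid j := (A * Nn j)%N.
Definition theta j k : R := k%:R * (2 * pi / (grid j)%:R).
Definition block j := index_iota (Nn j) (Nn j.+1).
Definition sigma j : R := Num.sqrt (energy (block j) a).

(** The children of the angle [k] at level [i] are the angles [k'] of level [i.+1]
with [k' %/ rho i = k]. *)
Fixpoint alive j k s : bool :=
  if j is i.+1 then
    [&& alive i (k %/ rho i)%N s,
        sqnorm (tsum a (Nn 0) (Nn j) (theta j k) s) <= r j ^+ 2 &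
        max4 (block i) (fun n => a n * cis (n%:R * theta j k)) s <= (C * sigma i) ^+ 4]
  else true.

Hypotheses (N0 : (0 < Nn 0)%N) (Nrho : forall j, Nn j.+1 = (rho j * Nn j)%N).
Hypotheses (rho4 : forall j, (4 <= rho j)%N) (A32 : (32 <= A)%N).
Hypotheses (delta0 : forall j, 0 < delta j) (delta2 : forall j, delta j <= 2 * delta j.+1).
Hypotheses (sgd : forall j, sigma j <= kap * delta j) (C0 : 0 < C) (kap0 : 0 < kap).

Lemma Nn_gt0 j : (0 < Nn j)%N.
Proof.
elim: j => // j IH; rewrite Nrho muln_gt0 IH andbT.
exact: leq_trans (rho4 j).
Qed.

Lemma Nn_step j : (4 * Nn j <= Nn j.+1)%N.
Proof. by rewrite Nrho leq_mul2r rho4 orbT. Qed.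

Lemma Nn_leS j : (Nn j <= Nn j.+1)%N.
Proof. by apply: leq_trans (Nn_step j); rewrite leq_pmull. Qed.

Lemma Nn_le i j : (i <= j)%N -> (Nn i <= Nn j)%N.
Proof.
move=> /subnKC <-; elim: (j - i)%N => [|k IH]; first by rewrite addn0.
by rewrite addnS (leq_trans IH) ?Nn_leS.
Qed.

Lemma grid_gt0 j : (0 < grid j)%N.
Proof. by rewrite muln_gt0 Nn_gt0 andbT (leq_trans _ A32). Qed.

Lemma gridS j : grid j.+1 = (rho j * grid j)%N.
Proof. by rewrite /grid Nrho mulnCA. Qed.

Definition mesh j : R := 2 * pi / (grid j)%:R.

Lemma mesh_gt0 j : 0 < mesh j.
Proof. by rewrite divr_gt0 ?mulr_gt0 ?pi_gt0 // ltr0n grid_gt0. Qed.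

Lemma meshS j : mesh j = (rho j)%:R * mesh j.+1.
Proof.
rewrite /mesh gridS natrM; field; rewrite !pnatr_eq0 -!lt0n grid_gt0 /=.
exact: leq_trans (rho4 j).
Qed.

Lemma meshS_le j : 4 * mesh j.+1 <= mesh j.
Proof. by rewrite (meshS j) ler_pM2r ?mesh_gt0 // ler_nat. Qed.

Lemma thetaE j k : theta j k = k%:R * mesh j. Proof. by []. Qed.

(** The arcs starting at the grid angles are nested along the tree. *)
Lemma theta_parent j k :
  theta j (k %/ rho j)%N <= theta j.+1 k /\
  theta j.+1 k + mesh j.+1 <= theta j (k %/ rho j)%N + mesh j.
Proof.
rewrite !thetaE (meshS j) mulrA -natrM; split.
  by rewrite ler_pM2r ?mesh_gt0 // ler_nat leq_trunc_div.
rewrite -[X in _ + X <= _]mul1r -!mulrDl natr1 -natrD ler_pM2r ?mesh_gt0 // ler_nat.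
rewrite -mulSnr; apply: ltn_ceil; exact: leq_trans (rho4 j).
Qed.

Lemma ancestor i j k s : (j <= i)%N -> alive i k s ->
  exists k', [/\ alive j k' s, theta j k' <= theta i k &
                 theta i k + mesh i <= theta j k' + mesh j].
Proof.
move=> ji; rewrite -(subnKC ji); move: (i - j)%N => d.
elim: d k => [|d IH] k; first by rewrite addn0 => al; exists k.
rewrite addnS => /and3P[al _ _].
have [k' [al' h1 h2]] := IH _ al; have [g1 g2] := theta_parent (j + d) k.
by exists k'; split => //; [exact: le_trans g1|exact: le_trans h2].
Qed.

Lemma sigma_ge0 j : 0 <= sigma j. Proof. exact: sqrtr_ge0. Qed.

Lemma two_mesh_le j : 2 * (Nn j)%:R * (2 * mesh j) <= 1.
Proof.
have Nj : 0 < (Nn j)%:R :> R by rewrite ltr0n Nn_gt0.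
have A0 : 0 < A%:R :> R by rewrite ltr0n (leq_trans _ A32).
have -> : 2 * (Nn j)%:R * (2 * mesh j) = 8 * pi / A%:R.
  by rewrite /mesh /grid natrM; field; rewrite !gt_eqF.
rewrite ler_pdivrMr // mul1r; apply: (@le_trans _ _ 32%:R); last by rewrite ler_nat.
by have := pi_lt4; lra.
Qed.

Lemma block_near_le j k s t : alive j.+1 k s -> `|t - theta j.+1 k| <= 2 * mesh j.+1 ->
  forall m, (Nn j <= m <= Nn j.+1)%N -> cnorm (tsum a (Nn j) m t s) <= 2 * (C * sigma j).
Proof.
move=> /and3P[_ _ mx] tk m mM; rewrite -[2]/(1 + 1).
have B0 : 0 <= C * sigma j by rewrite mulr_ge0 ?sigma_ge0 // ltW.
apply: (tsum_near_le (t := theta j.+1 k) (M := Nn j.+1)) => //.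
  exact: max4_tsum_le.
apply: le_trans (two_mesh_le j.+1); rewrite ler_wpM2l //.
Qed.

Definition Lip : R := 16 * (C * kap).

Lemma Lip_gt0 : 0 < Lip. Proof. by rewrite /Lip !mulr_gt0. Qed.

(** The block sums near an alive angle are Lipschitz of order
[N_(j+1) delta_j], and these constants grow geometrically, so the last
block dominates. *)
Lemma alive_lipschitz j k s : alive j k s -> forall t t',
  `|t - theta j k| <= 2 * mesh j -> `|t' - theta j k| <= 2 * mesh j ->
  cnorm (tsum a (Nn 0) (Nn j) t' s - tsum a (Nn 0) (Nn j) t s) <=
  Lip * ((Nn j)%:R * delta j) * `|t' - t|.
Proof.
elim: j k => [|j IH] k al t t' tk t'k.
  rewrite /tsum !big_geq // subrr cnorm0; apply: mulr_ge0 => //.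
  exact: mulr_ge0 (ltW Lip_gt0) (mulr_ge0 (ler0n _ _) (ltW (delta0 0))).
have [h1 h2] := theta_parent j k.
have far u : `|u - theta j.+1 k| <= 2 * mesh j.+1 ->
    `|u - theta j (k %/ rho j)%N| <= 2 * mesh j.
  have := meshS_le j; have := mesh_gt0 j.+1.
  by rewrite !ler_norml => m0 m4 /andP[g1 g2]; apply/andP; split; lra.
have al' : alive j (k %/ rho j)%N s by case/and3P: al.
have NNj : (Nn 0 <= Nn j <= Nn j.+1)%N by rewrite Nn_le // Nn_leS.
have {}IH := IH _ al' _ _ (far _ tk) (far _ t'k).
rewrite !(tsum_cat _ _ _ NNj) opprD addrACA.
apply: le_trans (cnormD _ _) _.
have bl : cnorm (tsum a (Nn j) (Nn j.+1) t' s - tsum a (Nn j) (Nn j.+1) t s) <=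
    2 * (Nn j.+1)%:R * `|t' - t| * (2 * (C * sigma j)).
  apply: tsum_shift_le; first exact: Nn_leS.
  exact: block_near_le tk.
apply: le_trans (lerD IH bl) _.
have d0 := normr_ge0 (t' - t); set d := `|t' - t| in d0 *.
have n1 : 0 <= (Nn j.+1)%:R :> R by rewrite ler0n.
have nn : 4 * (Nn j)%:R <= (Nn j.+1)%:R :> R by rewrite -natrM ler_nat Nn_step.
have e1 : (Nn j)%:R * delta j <= (Nn j.+1)%:R / 4 * (2 * delta j.+1).
  by rewrite ler_pM ?(ltW (delta0 _)) //; lra.
have e2 : Lip * ((Nn j)%:R * delta j) <= Lip * ((Nn j.+1)%:R / 4 * (2 * delta j.+1)).
  by rewrite ler_wpM2l // ltW // Lip_gt0.
have e3 : (Nn j.+1)%:R * (C * sigma j) <= (Nn j.+1)%:R * (C * (kap * (2 * delta j.+1))).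
  rewrite ler_wpM2l // ler_wpM2l ?(ltW C0) //; apply: le_trans (sgd j) _.
  by rewrite ler_wpM2l ?(ltW kap0).
have : (Lip * ((Nn j)%:R * delta j) + 4 * ((Nn j.+1)%:R * (C * sigma j))) * d <=
    (Lip * ((Nn j.+1)%:R * delta j.+1)) * d.
  by rewrite ler_wpM2r //; move: e2 e3; rewrite /Lip; lra.
by lra.
Qed.

(** The smallest alive angles increase with the level, because the parent of an
alive angle is alive.  Every ancestor of a late one lies within one mesh, so their
supremum is close to an alive angle of each level. *)
Lemma limit_angle s : (forall j, exists k, (k < grid j)%N && alive j k s) ->
  exists t, forall j, exists k, alive j k s /\ `|t - theta j k| <= 2 * mesh j.
Proof.
move=> al.
pose m j := ex_minn (al j); pose x j := theta j (m j).
have mal j : alive j (m j) s by rewrite /m; case: ex_minnP => k /andP[].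
have mlt j : (m j < grid j)%N by rewrite /m; case: ex_minnP => k /andP[].
have mmin j k : (k < grid j)%N -> alive j k s -> (m j <= k)%N.
  by move=> kg ka; rewrite /m; case: ex_minnP => i _; apply; rewrite kg.
have xS j : x j <= x j.+1.
  have [h1 _] := theta_parent j (m j.+1); apply: le_trans h1.
  rewrite /x !thetaE ler_pM2r ?mesh_gt0 // ler_nat; apply: mmin.
    by rewrite ltn_divLR ?(leq_trans _ (rho4 j)) // mulnC -gridS.
  by case/and3P: (mal j.+1).
have xmono i j : (i <= j)%N -> x i <= x j.
  move=> /subnKC <-; elim: (j - i)%N => [|k IH]; first by rewrite addn0.
  by rewrite addnS (le_trans IH).
have xub j : x j <= 2 * pi.
  have g0 : 0 < (grid j)%:R :> R by rewrite ltr0n grid_gt0.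
  rewrite /x /theta mulrA ler_pdivrMr // mulrC ler_wpM2l ?mulr_ge0 ?pi_ge0 //.
  by rewrite ler_nat ltnW.
pose X := [set x j | j in [set: nat]].
have supX : has_sup X.
  split; first by exists (x 0%N), 0%N.
  by exists (2 * pi) => _ [j _ <-].
exists (sup X) => j.
have [_ [i _ <-] xi] := sup_adherent (mesh_gt0 j) supX.
pose i' := maxn i j.
have xi' : sup X - mesh j < x i' by apply: lt_le_trans xi (xmono _ _ (leq_maxl _ _)).
have xsup : x i' <= sup X by apply: sup_upper_bound => //; exists i'.
have [k [ka h1 h2]] := ancestor (leq_maxr i j) (mal i').
exists k; split => //; rewrite ler_norml.
have := mesh_gt0 j; have := mesh_gt0 i'; rewrite -/i' -/(x i') in h1 h2.
by move=> mi mj; apply/andP; split; lra.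
Qed.

Hypotheses (delta_cvg : forall e : R, 0 < e -> exists j0, forall j, (j0 <= j)%N -> delta j <= e).
Hypotheses (r_cvg : forall e : R, 0 < e -> exists j0, forall j, (j0 <= j)%N -> r j <= e).
Hypotheses (r0 : forall j, 0 <= r j).

Lemma alive_cvg s : (forall j, exists k, (k < grid j)%N && alive j k s) ->
  exists t, forall e : R, 0 < e -> exists M0, forall M, (M0 <= M)%N ->
    cnorm (tsum a (Nn 0) M t s) <= e.
Proof.
move=> /limit_angle[t tP]; exists t => e e0.
pose D := Lip + 2 * (C * kap).
have D0 : 0 < D by rewrite addr_gt0 ?Lip_gt0 // !mulr_gt0.
have [j1 J1] := r_cvg (divr_gt0 e0 (ltr0n R 2)).
have [j2 J2] := delta_cvg (divr_gt0 e0 (mulr_gt0 (ltr0n R 2) D0)).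
pose j0 := (maxn j1 j2).+1.
exists (Nn j0) => M M0.
have [j jM] : exists j, (j0 <= j)%N && (Nn j <= M < Nn j.+1)%N.
  have ex : exists j, (M < Nn j)%N.
    exists M; elim: M {M0} => [|n IH]; first exact: Nn_gt0.
    by move: IH; have := Nn_step n; have := Nn_gt0 n; lia.
  have [j Mj jmin] := ex_minnP ex.
  case: j Mj jmin => [|j] Mj jmin.
    by have := leq_trans Mj (Nn_le (leq0n j0)); rewrite ltnNge M0.
  have NjM : (Nn j <= M)%N by rewrite leqNgt; apply/negP => /jmin; rewrite ltnn.
  exists j; rewrite NjM Mj !andbT leqNgt; apply/negP => jj0.
  by have := leq_trans Mj (Nn_le jj0); rewrite ltnNge M0.
case/and3P: jM => j0j NjM MNj.
have [k [ka tk]] := tP j; have [k' [ka' tk']] := tP j.+1.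
have NNj : (Nn 0 <= Nn j <= M)%N by rewrite Nn_le.
rewrite (tsum_cat _ _ _ NNj); apply: le_trans (cnormD _ _) _.
have h1 := block_near_le ka' tk' (m := M).
rewrite NjM (ltnW MNj) in h1; have {}h1 := h1 isT.
have h2 : cnorm (tsum a (Nn 0) (Nn j) t s - tsum a (Nn 0) (Nn j) (theta j k) s) <=
    Lip * delta j.
  apply: le_trans (alive_lipschitz ka (t := theta j k) (t' := t) _ tk) _.
    by rewrite subrr normr0 mulr_ge0 // ltW // mesh_gt0.
  apply: (@le_trans _ _ (Lip * delta j * ((Nn j)%:R * (2 * mesh j)))).
    rewrite [leLHS](_ : _ = Lip * delta j * ((Nn j)%:R * `|t - theta j k|)); last by ring.
    apply: ler_wpM2l; first exact: mulr_ge0 (ltW Lip_gt0) (ltW (delta0 j)).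
    by rewrite ler_wpM2l.
  rewrite ler_piMr //; first by rewrite mulr_ge0 // ltW // Lip_gt0.
  have := two_mesh_le j; have : 0 <= (Nn j)%:R * (2 * mesh j).
    exact: mulr_ge0 (ler0n _ _) (mulr_ge0 (ler0n _ 2) (ltW (mesh_gt0 j))).
  lra.
have h3 : cnorm (tsum a (Nn 0) (Nn j) (theta j k) s) <= r j.
  case: j j0j {NjM MNj ka' tk' NNj h1 h2} ka tk => [//|j] _ /and3P[_ + _] _.
  exact: cnorm_le.
have h4 := cnormD (tsum a (Nn 0) (Nn j) t s - tsum a (Nn 0) (Nn j) (theta j k) s)
  (tsum a (Nn 0) (Nn j) (theta j k) s); rewrite subrK in h4.
have jj1 : (j1 <= j)%N by apply: leq_trans j0j; rewrite leqW // leq_maxl.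
have jj2 : (j2 <= j)%N by apply: leq_trans j0j; rewrite leqW // leq_maxr.
have := J2 _ jj2; rewrite ler_pdivlMr ?mulr_gt0 // => g2.
have := J1 _ jj1 => g1.
have : C * sigma j <= C * (kap * delta j) by rewrite ler_wpM2l ?(ltW C0).
by move: g2; rewrite /D; move: h1 h2 h3 h4 g1; lra.
Qed.

Hypotheses (c0 : 0 < c) (Ac : 8 * Lip <= c * A%:R / 4).
Hypotheses (sg_ge : forall j, delta j <= sigma j).
Hypothesis rS : forall j,
  r j.+1 = Num.max (r j - c / 4 * delta j) ((C ^+ 2 / c + C) * kap * delta j).

(** The partial sum at the parent is at most [r j], and moving to the child changes
it by at most a quarter of the gain [c * sigma j] because the grid is [A] times
finer than the frequencies; then [steer_le] applies. *)
Lemma alive_step j k s : alive j (k %/ rho j)%N s ->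
  dot (dir (tsum a (Nn 0) (Nn j) (theta j.+1 k) s))
      (tsum a (Nn j) (Nn j.+1) (theta j.+1 k) s) <= - c * sigma j ->
  max4 (block j) (fun n => a n * cis (n%:R * theta j.+1 k)) s <= (C * sigma j) ^+ 4 ->
  alive j.+1 k s.
Proof.
move=> al dt mx; apply/and3P; split => //.
have B0 : 0 <= C * sigma j by rewrite mulr_ge0 ?sigma_ge0 // ltW.
have NNj : (Nn 0 <= Nn j <= Nn j.+1)%N by rewrite Nn_le // Nn_leS.
apply: sqnorm_le; rewrite (tsum_cat _ _ _ NNj).
set x := tsum a (Nn 0) _ _ _ in dt *; set y := tsum a (Nn j) _ _ _ in dt *.
have yC : cnorm y <= C * sigma j by apply: (max4_tsum_le B0 mx); rewrite leqnn Nn_leS.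
have [h1 h2] := theta_parent j k.
have m0 := mesh_gt0 j; have m1 := mesh_gt0 j.+1.
have tk : `|theta j.+1 k - theta j (k %/ rho j)%N| <= mesh j.
  by rewrite ler_norml; apply/andP; split; lra.
have xr : cnorm x <= r j + c / 4 * delta j.
  have h3 : cnorm (tsum a (Nn 0) (Nn j) (theta j (k %/ rho j)%N) s) <= r j.
    case: (j) al => [_|i /and3P[_ + _]]; first by rewrite /tsum big_geq // cnorm0.
    exact: cnorm_le.
  have h4 := cnormD (x - tsum a (Nn 0) (Nn j) (theta j (k %/ rho j)%N) s)
    (tsum a (Nn 0) (Nn j) (theta j (k %/ rho j)%N) s); rewrite subrK in h4.
  apply: le_trans h4 _; rewrite addrC lerD //.
  apply: le_trans (alive_lipschitz al (t := theta j (k %/ rho j)%N) (t' := theta j.+1 k) _ _) _.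
  - by rewrite subrr normr0 mulr_ge0 // ltW.
  - by lra.
  apply: (@le_trans _ _ (Lip * delta j * ((Nn j)%:R * mesh j))).
    rewrite [leLHS](_ : _ = Lip * delta j * ((Nn j)%:R * `|theta j.+1 k - theta j (k %/ rho j)%N|)); last by ring.
    apply: ler_wpM2l; first exact: mulr_ge0 (ltW Lip_gt0) (ltW (delta0 j)).
    by rewrite ler_wpM2l.
  have A0 : 0 < A%:R :> R by rewrite ltr0n (leq_trans _ A32).
  have -> : (Nn j)%:R * mesh j = 2 * pi / A%:R.
    have Nj : 0 < (Nn j)%:R :> R by rewrite ltr0n Nn_gt0.
    by rewrite /mesh /grid natrM; field; rewrite !gt_eqF.
  rewrite mulrA ler_pdivrMr // mulrAC [leRHS]mulrAC ler_wpM2r ?(ltW (delta0 _)) //.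
  have : Lip * pi <= Lip * 4 by rewrite ler_wpM2l ?(ltW Lip_gt0) // ltW // pi_lt4.
  by move: Ac; lra.
have sg0 : 0 < sigma j := lt_le_trans (delta0 j) (sg_ge j).
apply: le_trans (steer_le c0 C0 sg0 dt yC xr) _.
rewrite rS ge_max !le_max; apply/andP; split; apply/orP; [left|right].
  have : c * delta j <= c * sigma j by rewrite ler_wpM2l // ltW.
  by lra.
rewrite -mulrA ler_wpM2l // addr_ge0 ?(ltW C0) // divr_ge0 ?sqr_ge0 // ltW //.
Qed.



Variable sc : R.
Hypotheses (sc0 : 0 < sc) (sc1 : sc <= 1) (scK : sc ^+ 2 * 240 ^+ 2 = 1 / 4).
Hypotheses (cE : c = sc / 16) (CE : C = 2 / sc).
Hypothesis a_small : forall j n, (Nn j <= n)%N -> sqnorm (a n) <= delta j ^+ 2 / (Nn j)%:R.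
Hypothesis rho_big : forall j, 128 / sc ^+ 2 <= (rho j)%:R.

Definition survivors j s : R := \sum_(k < grid j | alive j k s) 1.

Lemma eq_alive j k s s' : (forall n, (Nn 0 <= n < Nn j)%N -> s n = s' n) ->
  alive j k s = alive j k s'.
Proof.
elim: j k => // j IH k ss' /=.
have NNj : (Nn 0 <= Nn j <= Nn j.+1)%N by rewrite Nn_le // Nn_leS.
rewrite (IH _ _) => [|n /andP[h1 h2]]; last first.
  by apply: ss'; rewrite h1 (leq_trans h2) // Nn_leS.
rewrite (eq_tsum _ _ ss'); congr [&& _, _ & _ <= _].
apply: eq_max4 => n; rewrite mem_index_iota => /andP[h1 h2].
by apply: ss'; rewrite h2 andbT; case/andP: NNj => h3 _; exact: leq_trans h1.
Qed.

Lemma eq_survivors j s s' : (forall n, (Nn 0 <= n < Nn j)%N -> s n = s' n) ->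
  survivors j s = survivors j s'.
Proof. by move=> ss'; apply: eq_bigl => k; exact: eq_alive. Qed.

Lemma sum_parent (f : nat -> R) (m g : nat) : (0 < m)%N ->
  \sum_(k < (m * g)%N) f (k %/ m)%N = m%:R * \sum_(k < g) f k.
Proof.
move=> m0; rewrite -(big_mkord xpredT (fun k => f (k %/ m)%N)).
elim: g => [|g IH]; first by rewrite muln0 big_geq // big_ord0 mulr0.
rewrite big_ord_recr mulrDr -IH /= mulnS addnC (big_cat_nat (leq0n _) (leq_addr m _)) /=.
congr (_ + _); rewrite -{1}[(m * g)%N]add0n big_addn addKn big_mkord.
rewrite (eq_bigr (fun=> f g)) ?sumr_const ?card_ord ?mulr_natl // => i _.
by rewrite addnC mulnC divnMDl // divn_small ?addn0.
Qed.

Lemma children_count j s :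
  \sum_(k < grid j.+1 | alive j (k %/ rho j)%N s) (1 : R) = (rho j)%:R * survivors j s.
Proof.
rewrite /survivors big_mkcond gridS (sum_parent (fun k => if alive j k s then 1 else 0)).
  by rewrite -big_mkcond.
exact: leq_trans (rho4 j).
Qed.

Lemma mode_cis j k : mode (cis (mesh j)) a k = fun n => a n * cis (n%:R * theta j k).
Proof. by apply/funext => n; rewrite /mode !cisX. Qed.

(** All signs before the block are those of [s], so the set of children and the
directions of their partial sums are deterministic and [prob_few_good] applies.
A proportion [sc ^+ 2 / 32] of good children means at least
four per parent since each parent has at least [128 / sc ^+ 2] of them. *)
Lemma survivors_step j s : 0 < survivors j s ->
  expect (block j) (fun s' => (survivors j.+1 s' < 4 * survivors j s')%R%:R) s <=
  block_cst sc * Num.sqrt (A%:R / survivors j s).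
Proof.
move=> S0; set q := grid j.+1; set w := cis (mesh j.+1).
set U := fun k => alive j (k %/ rho j)%N s.
set u := fun k => dir (tsum a (Nn 0) (Nn j) (theta j.+1 k) s).
set tau := delta j ^+ 2 / (Nn j)%:R.
have prw : q.-primitive_root w by apply: cis_prim; exact: grid_gt0.
have Nj : 0 < (Nn j)%:R :> R by rewrite ltr0n Nn_gt0.
have rj : 0 < (rho j)%:R :> R by rewrite ltr0n (leq_trans _ (rho4 j)).
have A0 : 0 < A%:R :> R by rewrite ltr0n (leq_trans _ A32).
have tau0 : 0 <= tau by rewrite divr_ge0 ?sqr_ge0.
have lq : all (fun m => (m.*2 < q)%N) (block j).
  apply/allP => m; rewrite mem_index_iota => /andP[_ mN]; rewrite /q /grid.
  apply: (@leq_trans (2 * Nn j.+1)%N); first by rewrite -mul2n ltn_mul2l.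
  by rewrite leq_mul2r (leq_trans _ A32) ?orbT.
have bt n : n \in block j -> sqnorm (a n) <= tau.
  by rewrite mem_index_iota => /andP[h _]; exact: a_small.
have u1 k : sqnorm (u k) = 1 by exact: sqnorm_dir.
have NuE : \sum_(k < q | U k) 1 = (rho j)%:R * survivors j s by exact: children_count.
have sg0 : 0 < sigma j := lt_le_trans (delta0 j) (sg_ge j).
have V0 : 0 < energy (block j) a by rewrite -sqrtr_gt0.
have Nu0 : 0 < \sum_(k < q | U k) (1 : R) by rewrite NuE mulr_gt0.
have few := @prob_few_good R q w U a (block j) tau u prw (sqnorm_cis _) tau0
  (iota_uniq _ _) lq bt u1 sc sc0 sc1 scK s V0 Nu0.
apply: (@le_trans _ _ (expect (block j) (fun s' => (\sum_(k < q | U k && good w a (block j) u sc s' k)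
   (1 : R) < sc ^+ 2 / 32 * \sum_(k < q | U k) 1)%R%:R) s)).
  apply: expect_le_loc => s' ss'; rewrite ler_nat.
  have off n : (Nn 0 <= n < Nn j)%N -> s' n = s n.
    by move=> /andP[_ nj]; apply: ss'; rewrite mem_index_iota negb_and -ltnNge nj.
  case: (boolP (survivors j.+1 s' < _)) => // fail; rewrite lt0b.
  apply: (@le_lt_trans _ _ (survivors j.+1 s')).
    rewrite /survivors [leLHS]big_mkcond [leRHS]big_mkcond; apply: ler_sum => k _.
    case: ifP => [/andP[Uk /andP[gd gm]]|_]; last by case: ifP.
    suff -> : alive j.+1 k s' by [].
    rewrite (mode_cis j.+1) in gd gm; apply: alive_step.
    - by rewrite (eq_alive _ off).
    - by rewrite (eq_tsum _ _ off) cE.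
    - by rewrite CE.
  apply: lt_le_trans fail _; rewrite NuE (eq_survivors off) mulrA ler_wpM2r ?(ltW S0) //.
  have sc2 : 0 < sc ^+ 2 by rewrite exprn_gt0.
  by have := rho_big j; rewrite ler_pdivrMr //; lra.
apply: le_trans few _; rewrite ler_wpM2l ?block_cst_ge0 //.
set T := tau * _ * _; have T0 : 0 <= T by rewrite !mulr_ge0 // ltW.
rewrite -[leLHS]ger0_norm; last by rewrite divr_ge0 ?mulr_ge0 ?sqrtr_ge0 // ltW.
rewrite -sqrtr_sqr ler_wsqrtr // expr_div_n exprMn sqr_sqrtr // -/(sigma j) NuE.
have -> : T = delta j ^+ 2 * (A%:R * (rho j)%:R ^+ 2 * survivors j s).
  by rewrite /T NuE /tau /q gridS /grid !natrM; field; rewrite gt_eqF.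
have -> : delta j ^+ 2 * (A%:R * (rho j)%:R ^+ 2 * survivors j s) /
    (sigma j ^+ 2 * ((rho j)%:R * survivors j s) ^+ 2) =
    (delta j / sigma j) ^+ 2 * (A%:R / survivors j s).
  by field; rewrite !gt_eqF.
rewrite ler_piMl ?divr_ge0 ?(ltW A0) ?(ltW S0) //.
rewrite exprn_ile1 ?divr_ge0 ?(ltW (delta0 j)) ?(ltW sg0) //.
by rewrite ler_pdivrMr // mul1r.
Qed.

Definition fails m s : bool :=
  has (fun i => survivors i.+1 s < 4 * survivors i s) (iota 0 m).

Lemma failsS m s : fails m.+1 s = fails m s || (survivors m.+1 s < 4 * survivors m s).
Proof. by rewrite /fails -[in iota 0 m.+1]addn1 iotaD has_cat /= add0n orbF. Qed.

Lemma survivors0 s : survivors 0 s = (grid 0)%:R.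
Proof. by rewrite /survivors sumr_const card_ord. Qed.

Lemma survivors_ge m s : ~~ fails m s -> 4 ^+ m * (grid 0)%:R <= survivors m s.
Proof.
elim: m => [|m IH]; first by rewrite expr0 mul1r survivors0.
rewrite failsS negb_or -leNgt => /andP[/IH h1 h2]; apply: le_trans h2.
by rewrite exprS -mulrA ler_wpM2l.
Qed.

Lemma eq_fails m s s' : (forall n, (Nn 0 <= n < Nn m)%N -> s n = s' n) ->
  fails m s = fails m s'.
Proof.
move=> ss'; apply: eq_in_has => i; rewrite mem_iota add0n => /andP[_ im].
by congr (_ < 4 * _); apply: eq_survivors => n /andP[h1 h2]; apply: ss';
  rewrite h1 (leq_trans h2) // Nn_le // ltnW.
Qed.

(** Before the first failure the population at level [m] is at least
[4 ^+ m * grid 0], so the failure probabilities form a geometric series. *)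
Lemma expect_fails m s : expect (index_iota 1 (Nn m)) (fun s => (fails m s)%:R) s <=
  block_cst sc * Num.sqrt (A%:R / (grid 0)%:R) * \sum_(i < m) 2^-1 ^+ i.
Proof.
have A0 : 0 < A%:R :> R by rewrite ltr0n (leq_trans _ A32).
have G0 : 0 < (grid 0)%:R :> R by rewrite ltr0n grid_gt0.
elim: m => [|m IH].
  rewrite big_ord0 mulr0 (@expect_eq R _ _ (fun=> 0)) ?expect_cst // => s'.
set K := block_cst sc * _ in IH *.
have NN : index_iota 1 (Nn m.+1) = index_iota 1 (Nn m) ++ block m.
  rewrite /block /index_iota -[X in _ ++ iota X _](subnKC (Nn_gt0 m)) -iotaD.
  by congr iota; rewrite addnC addnBA ?Nn_gt0 // subnK ?Nn_leS.
pose g s' : R := (fails m s')%:R.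
pose h s' : R := (~~ fails m s' && (survivors m.+1 s' < 4 * survivors m s'))%:R.
apply: (@le_trans _ _ (expect (index_iota 1 (Nn m.+1)) (fun s' => g s' + h s') s)).
  apply: expect_le => s'; rewrite failsS /g /h.
  by case: (fails m s'); case: (_ < _); rewrite /= ?addr0 ?add0r.
rewrite expectD big_ord_recr mulrDr; apply: lerD.
  apply: le_trans IH; rewrite NN expect_cat; apply: expect_le => s'.
  rewrite (expect_loc (s := s')) // => s'' ss''; rewrite /g; congr (_%:R); congr nat_of_bool.
  apply: eq_fails => n /andP[_ cnorm]; apply: ss''.
  by rewrite mem_index_iota negb_and -ltnNge cnorm.
rewrite NN expect_cat -[leRHS](expect_cst (index_iota 1 (Nn m)) _ s); apply: expect_le => s'.
have [fs|nfs] := boolP (fails m s').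
  rewrite (@expect_eq_loc R _ _ (fun=> 0)) ?expect_cst.
    apply: mulr_ge0; last by apply: exprn_ge0; rewrite invr_ge0.
    exact: mulr_ge0 (block_cst_ge0 sc0) (sqrtr_ge0 _).
  move=> s'' ss''; rewrite /h (eq_fails (s' := s')) ?fs // => n /andP[_ cnorm]; apply: ss''.
  by rewrite mem_index_iota negb_and -ltnNge cnorm.
have sv := survivors_ge nfs.
have sv0 : 0 < survivors m s' by apply: lt_le_trans sv; rewrite mulr_gt0 ?exprn_gt0.
apply: (@le_trans _ _ (block_cst sc * Num.sqrt (A%:R / survivors m s'))).
  apply: le_trans (survivors_step sv0); apply: expect_le => s''.
  by rewrite /h; case: (fails m s'').
rewrite /K -[leRHS]mulrA; apply: ler_wpM2l; first exact: block_cst_ge0.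
have -> : Num.sqrt (A%:R / (grid 0)%:R : R) * 2^-1 ^+ m =
    Num.sqrt (A%:R / (4 ^+ m * (grid 0)%:R)).
  have h0 : 0 <= (2^-1 : R) ^+ m by rewrite exprn_ge0 // invr_ge0.
  rewrite -(ger0_norm h0) -sqrtr_sqr -sqrtrM; last by rewrite divr_ge0 // ltW.
  have -> : (4 : R) ^+ m = (2 ^+ m) ^+ 2.
    by rewrite -exprM mulnC exprM; congr (_ ^+ m); rewrite expr2 -natrM.
  congr (Num.sqrt _); rewrite exprVn; field.
  by rewrite gt_eqF // expf_neq0 // pnatr_eq0.
rewrite ler_wsqrtr // ler_wpM2l ?(ltW A0) // lef_pV2 // posrE //.
by rewrite mulr_gt0 ?exprn_gt0.
Qed.

Lemma sum_half m : \sum_(i < m) (2^-1 : R) ^+ i <= 2.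
Proof.
have -> : \sum_(i < m) (2^-1 : R) ^+ i = 2 - 2 * 2^-1 ^+ m.
  elim: m => [|m IH]; first by rewrite big_ord0 expr0; lra.
  by rewrite big_ord_recr /= IH exprS; field.
have : 0 <= (2^-1 : R) ^+ m by rewrite exprn_ge0 // invr_ge0.
lra.
Qed.

Lemma survivors_alive j s : 0 < survivors j s -> exists k, (k < grid j)%N && alive j k s.
Proof.
case: (pselect (exists k, (k < grid j)%N && alive j k s)) => // no.
rewrite /survivors big_pred0 ?ltxx // => k; apply/negP => al.
by apply: no; exists k; rewrite ltn_ord.
Qed.

End Tree.

(** * Choice of the scales *)

Section Scales.
Variable R : realType.
Implicit Types (s : nat -> bool) (y delta r : nat -> R) (a : nat -> R[i]).

Definition vanishes y := forall e : R, 0 < e -> exists j0, forall j, (j0 <= j)%N -> y j <= e.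

Lemma exists_nat_ge (x : R) : exists n : nat, x <= n%:R.
Proof.
exists (Num.bound `|x|); apply: le_trans (ler_norm x) _.
exact/ltW/archi_boundP.
Qed.

Lemma vanishes_inv : vanishes (fun n => n.+1%:R^-1).
Proof.
move=> e e0; have [N Ne] := exists_nat_ge e^-1; exists N => j Nj.
rewrite -[leRHS]invrK lef_pV2 ?posrE ?invr_gt0 ?ltr0n //.
by apply: le_trans Ne _; rewrite ler_nat ltnW.
Qed.

(** Halves exactly when all later terms allow it, which keeps consecutive values
within a factor two. *)
Fixpoint halving y (D : R) j : R :=
  if j is i.+1 then
    let d := halving y D i in
    if `[< forall n, (i < n)%N -> y n <= d / 2 >] then d / 2 else d
  else D.

Lemma slow_majorant y : (forall n, 0 <= y n) -> vanishes y ->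
  exists delta, [/\ forall j, 0 < delta j, forall j, delta j <= 2 * delta j.+1,
    forall j n, (j <= n)%N -> y n <= delta j & vanishes delta].
Proof.
move=> y0 yv.
have [D D0 yD] : exists2 D, 0 < D & forall n, y n <= D.
  have [N yN] := yv 1 ltr01; exists (1 + \sum_(i < N) y i).
    by rewrite ltr_pwDl // sumr_ge0.
  move=> n; have [Nn|nN] := leqP N n.
    by apply: le_trans (yN n Nn) _; rewrite lerDl sumr_ge0.
  rewrite (bigD1 (Ordinal nN)) //= addrCA lerDl addr_ge0 // sumr_ge0 //.
pose d := halving y D.
have dS j : d j.+1 = if `[< forall n, (j < n)%N -> y n <= d j / 2 >] then d j / 2 else d j by [].
have d0 j : 0 < d j.
  by elim: j => // j IH; rewrite dS; case: ifP => // _; rewrite divr_gt0.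
have dle j : d j.+1 <= d j by rewrite dS; case: ifP => // _; have := d0 j; lra.
have dmono i j : (i <= j)%N -> d j <= d i.
  move=> /subnKC <-; elim: (j - i)%N => [|k IH]; first by rewrite addn0.
  by rewrite addnS (le_trans (dle _)).
exists d; split => //.
- by move=> j; rewrite dS; case: ifP => _; have := d0 j; lra.
- elim=> [|j IH] n jn; first exact: yD.
  by rewrite dS; case: asboolP => [|_]; [apply|apply: IH; exact: ltnW].
have small m : exists j, d j <= D / 2 ^+ m.
  elim: m => [|m [j jm]]; first by exists 0%N; rewrite expr0 divr1.
  have e0 : 0 < D / 2 ^+ m / 2 / 2 by rewrite !divr_gt0 // exprn_gt0.
  have [N yN] := yv _ e0; pose j1 := maxn j N.
  have E : D / 2 ^+ m.+1 = D / 2 ^+ m / 2 by rewrite exprSr invfM mulrA.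
  have [le|gt] := leP (d j1) (D / 2 ^+ m.+1); first by exists j1.
  exists j1.+1; rewrite dS asboolT.
    have : d j1 <= d j by rewrite dmono // leq_maxl.
    by rewrite E; lra.
  move=> n j1n; apply: le_trans (yN n _) _.
    by apply: leq_trans (leq_maxr j N) _; exact: ltnW.
  by move: gt; rewrite E; lra.
move=> e e0; have [m me] := exists_nat_ge (D / e); have [j dj] := small m.
exists j => i ji; apply: le_trans (dmono _ _ ji) _; apply: le_trans dj _.
rewrite ler_pdivrMr ?exprn_gt0 // mulrC -ler_pdivrMr //.
by apply: le_trans me _; rewrite -natrX ler_nat ltnW // ltn_expl.
Qed.

(** The recursion imposed by [alive_step]. *)
Fixpoint radius (c1 B1 : R) delta j : R :=
  if j is i.+1 then
    Num.max (radius c1 B1 delta i - c1 * delta i) (B1 * delta i)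
  else 0.

Lemma radius_ge0 (c1 B1 : R) delta j : 0 <= B1 -> (forall j, 0 < delta j) ->
  0 <= radius c1 B1 delta j.
Proof.
by move=> B0 d0; case: j => //= j; rewrite le_max [X in _ || X]mulr_ge0 ?orbT // ltW.
Qed.

(** Until it meets the barrier [B1 * delta j] the radius loses [c1 * delta j]
at each step, and these losses have divergent sum. *)
Lemma radius_vanishes (c1 B1 : R) delta : 0 < c1 -> 0 <= B1 ->
  (forall j, j.+1%:R^-1 <= delta j) -> vanishes delta ->
  vanishes (radius c1 B1 delta).
Proof.
move=> c10 B10 dharm dv e e0; set r := radius _ _ _.
have rS j : r j.+1 = Num.max (r j - c1 * delta j) (B1 * delta j) by [].
have d0 j : 0 < delta j by apply: lt_le_trans (dharm j); rewrite invr_gt0.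
have r0 j : 0 <= r j by exact: radius_ge0.
have [J dJ] : exists J, forall j, (J <= j)%N -> B1 * delta j <= e.
  have B2 : 0 < B1 + 1 by rewrite ltr_pwDr.
  have [J dJ] := dv _ (divr_gt0 e0 B2); exists J => j /dJ; rewrite ler_pdivlMr // => h.
  by have := d0 j; lra.
have stay j i : (J <= j)%N -> r j <= e -> (j <= i)%N -> r i <= e.
  move=> Jj rj /subnKC <-; elim: (i - j)%N => [|k IH]; first by rewrite addn0.
  rewrite addnS rS ge_max dJ ?andbT; last by rewrite (leq_trans Jj) // leq_addr.
  by have := mulr_gt0 c10 (d0 (j + k)%N); lra.
suff [j Jj rj] : exists2 j, (J <= j)%N & r j <= e.
  by exists j => i; exact: stay.
apply: contrapT => nor.
have big j : (J <= j)%N -> e < r j.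
  by move=> Jj; rewrite ltNge; apply/negP => rj; apply: nor; exists j.
have dec k : r (J + k)%N <= r J - c1 * \sum_(J <= i < J + k) i.+1%:R^-1.
  elim: k => [|k IH]; first by rewrite addn0 big_geq // mulr0 subr0.
  have := big (J + k).+1 (leqW (leq_addr _ _)); rewrite rS lt_max.
  rewrite addnS rS [X in _ || X]ltNge dJ ?leq_addr //= orbF => h.
  rewrite (max_idPl _); last by apply: le_trans (ltW h); rewrite dJ ?leq_addr.
  rewrite big_nat_recr ?leq_addr //= mulrDr.
  have : c1 * (J + k).+1%:R^-1 <= c1 * delta (J + k)%N by rewrite ler_wpM2l // ltW.
  by move: (c1 / (J + k).+1%:R) (\sum_(J <= i < J + k) _) IH => X S; lra.
apply: (@dvg_harmonic R); apply: nondecreasing_is_cvgn.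
  by apply: nondecreasing_series => n _ _; rewrite invr_ge0.
exists (\sum_(0 <= i < J) i.+1%:R^-1 + r J / c1) => _ [n _ <-].
rewrite /series /=; have [nJ|Jn] := leqP n J.
  rewrite -[leLHS]addr0 lerD ?divr_ge0 ?(ltW c10) //.
  rewrite (big_cat_nat (leq0n n) nJ) /= lerDl sumr_ge0 // => i _; by rewrite invr_ge0.
rewrite (big_cat_nat (leq0n J) (ltnW Jn)) /= lerD2l ler_pdivlMr // mulrC.
have := dec (n - J)%N; rewrite subnKC ?(ltnW Jn) //; have := r0 n; lra.
Qed.

Lemma energy_iota_le a i j i' j' : (i' <= i)%N -> (j <= j')%N ->
  energy (index_iota i j) a <= energy (index_iota i' j') a.
Proof.
move=> ii jj; have E0 m n := energy_ge0 (index_iota m n) a.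
have [ij|ji] := leqP i j; last first.
  have -> : index_iota i j = [::].
    by apply/eqP; rewrite -size_eq0 size_iota subn_eq0 ltnW.
  by rewrite energy_nil.
rewrite [leRHS](_ : _ = energy (index_iota i' i) a +
  (energy (index_iota i j) a + energy (index_iota j j') a)).
  by have := E0 i' i; have := E0 j j'; lra.
by rewrite /energy -!big_cat_nat // (leq_trans ij).
Qed.

(** Take the least multiple that reaches the energy [d ^+ 2]: the last [N] indices
contribute at most [d ^+ 2], so the target is overshot by a bounded factor only. *)
Lemma block_ratio a N (L : nat) (d : R) : (0 < N)%N -> (2 <= L)%N -> 0 < d ->
  (forall n, (N <= n)%N -> sqnorm (a n) <= d ^+ 2 / N%:R) ->
  (forall B, exists N', B <= energy (index_iota N N') a) ->
  exists rho, [/\ (L <= rho)%N, d ^+ 2 <= energy (index_iota N (rho * N)) a &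
     energy (index_iota N (rho * N)) a <= L%:R * d ^+ 2].
Proof.
move=> N0 L2 d0 aN div.
have len k m : (N <= m)%N -> energy (index_iota m (m + k * N)) a <= k%:R * d ^+ 2.
  move=> Nm; apply: (@le_trans _ _ (\sum_(m <= n < m + k * N) d ^+ 2 / N%:R)).
    rewrite /energy !big_nat; apply: ler_sum => n /andP[mn _].
    by apply: aN; exact: leq_trans mn.
  rewrite sumr_const_nat (_ : m + k * N - m = k * N)%N; last by rewrite addKn.
  rewrite mulnC mulrnA -[_ *+ N]mulr_natr divfK ?pnatr_eq0 -?lt0n //.
  by rewrite mulr_natl.
have ex : exists rho, (L <= rho)%N && (d ^+ 2 <= energy (index_iota N (rho * N)) a).
  have [N' N'B] := div (d ^+ 2); exists (maxn L N'); rewrite leq_maxl /=.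
  apply: le_trans N'B _; apply: energy_iota_le => //; apply: leq_trans (leq_maxr L N') _.
  by rewrite leq_pmulr.
have [rho /andP[Lr dr] rmin] := ex_minnP ex; exists rho; split => //.
have [->|Lnr] := eqVneq rho L.
  have := len (L.-1) N (leqnn N); rewrite -mulSn prednK; last exact: ltnW.
  by move=> h; apply: le_trans h _; rewrite ler_wpM2r ?sqr_ge0 // ler_nat leq_pred.
have r0 : (0 < rho)%N by apply: leq_trans Lr; exact: ltnW.
have lt1 : energy (index_iota N (rho.-1 * N)) a < d ^+ 2.
  rewrite ltNge; apply/negP => h; have := rmin rho.-1; rewrite h andbT.
  by rewrite -ltnS prednK // ltn_neqAle eq_sym Lnr Lr => /(_ isT); rewrite leqNgt ltn_predL r0.
have r1 : (0 < rho.-1)%N by rewrite -ltnS prednK // (leq_trans L2).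
have h := len 1%N (rho.-1 * N)%N (leq_pmull _ r1).
rewrite mul1n addnC -mulSn prednK // mul1r in h.
have -> : energy (index_iota N (rho * N)) a = energy (index_iota N (rho.-1 * N)) a +
   energy (index_iota (rho.-1 * N) (rho * N)) a.
  by rewrite /energy -big_cat_nat ?leq_pmull // leq_mul2r leq_pred orbT.
have : 2 * d ^+ 2 <= L%:R * d ^+ 2 by rewrite ler_wpM2r ?sqr_ge0 // ler_nat.
lra.
Qed.

Fixpoint levels (f : nat -> nat -> nat) (J j : nat) : nat :=
  if j is i.+1 then (f i (levels f J i) * levels f J i)%N else J.

(** Stated as a Cauchy condition so that both cases of the proof provide it in
the same form. *)
Definition converges_somewhere a s := exists t : R, forall e : R, 0 < e ->
  exists M0, forall M, (M0 <= M)%N -> cnorm (tsum a M0 M t s) <= e.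

(** The exceptional set of [Q] is covered by increasing unions of events that
depend on finitely many signs and have small probability.  Index 0 is excluded
as the series starts at 1. *)
Definition small_failure (Q : (nat -> bool) -> Prop) := forall e : R, 0 < e ->
  exists (F : nat -> (nat -> bool) -> bool) (D : nat -> nat),
  [/\ forall m, (0 < D m)%N, forall m s, F m s -> F m.+1 s,
      forall m s s', (forall n, (0 < n < D m)%N -> s n = s' n) -> F m s = F m s',
      forall m s, expect (index_iota 1 (D m)) (fun s => (F m s)%:R) s <= e &
      forall s, (forall m, ~~ F m s) -> Q s].

(** The order of the choices: [L] makes every parent have enough children, [A]
makes the grid fine enough for [alive_step], [delta] majorises the coefficients
and the harmonic sequence, and the starting level [J] makes the sum of the failure
probabilities small. *)
Lemma divergent_case a :
  vanishes (fun n => Num.sqrt n%:R * cnorm (a n)) ->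
  (forall N B, exists N', B <= energy (index_iota N N') a) ->
  small_failure (converges_somewhere a).
Proof.
move=> av div e e0.
(* Solves [sc ^+ 2 * 240 ^+ 2 = 1 / 4], where [240 ^+ 2] comes from [excess_max4]. *)
pose sc : R := 480^-1.
have sc0 : 0 < sc by rewrite invr_gt0 ltr0n.
have sc1 : sc <= 1 by rewrite invf_le1 ?ler1n ?ltr0n.
have scK : sc ^+ 2 * 240 ^+ 2 = 1 / 4 by rewrite /sc; field.
move: sc sc0 sc1 scK => sc sc0 sc1 scK.
have [c cE] : exists c, c = sc / 16 by exists (sc / 16).
have [C CE] : exists C, C = 2 / sc by exists (2 / sc).
have c0 : 0 < c by rewrite cE divr_gt0.
have C0 : 0 < C by rewrite CE divr_gt0.
have [L0 L0P] := exists_nat_ge (128 / sc ^+ 2); pose L := (L0 + 4)%N.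
have L4 : (4 <= L)%N by exact: leq_addl.
set kap : R := L%:R; have kap0 : 0 < kap by rewrite ltr0n (leq_trans _ L4).
have [A0 A0P] := exists_nat_ge (32 * Lip C kap / c); pose A := (A0 + 32)%N.
have A32 : (32 <= A)%N by exact: leq_addl.
have Ac : 8 * Lip C kap <= c * A%:R / 4.
  move: A0P; rewrite ler_pdivrMr // => h.
  have : c * A0%:R <= c * A%:R by rewrite ler_wpM2l ?(ltW c0) // ler_nat leq_addr.
  by move: h; move: (Lip C kap) (A%:R : R) (A0%:R : R) => x1 x2 x3; lra.
(* The harmonic term gives [delta] a divergent sum. *)
pose y n : R := Num.sqrt n%:R * cnorm (a n) + n.+1%:R^-1.
have y0 n : 0 <= y n by rewrite addr_ge0 ?invr_ge0 // mulr_ge0 ?sqrtr_ge0.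
have yv : vanishes y.
  move=> x x0; have x2 : 0 < x / 2 by rewrite divr_gt0.
  have [j1 J1] := av _ x2; have [j2 J2] := vanishes_inv x2.
  exists (maxn j1 j2) => j; rewrite geq_max => /andP[/J1 h1 /J2 h2].
  by rewrite /y (splitr x) lerD.
have [delta [d0 d2 dy dv]] := slow_majorant y0 yv.
have dharm j : j.+1%:R^-1 <= delta j.
  apply: le_trans (dy j j (leqnn j)); rewrite lerDr mulr_ge0 ?sqrtr_ge0 //.
set B1 := (C ^+ 2 / c + C) * kap.
have B10 : 0 <= B1.
  by rewrite mulr_ge0 ?(ltW kap0) // addr_ge0 ?(ltW C0) // divr_ge0 ?sqr_ge0 // ltW.
have c40 : 0 < c / 4 by rewrite divr_gt0.
pose r := radius (c / 4) B1 delta.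
have a_le j N n : (0 < N)%N -> (j <= N)%N -> (N <= n)%N ->
    sqnorm (a n) <= delta j ^+ 2 / N%:R.
  move=> N0 jN Nn; have n0 : 0 < n%:R :> R by rewrite ltr0n (leq_trans N0).
  have h : Num.sqrt n%:R * cnorm (a n) <= delta j.
    by apply: le_trans (dy j n (leq_trans jN Nn)); rewrite lerDl invr_ge0.
  have {}h : n%:R * sqnorm (a n) <= delta j ^+ 2.
    rewrite -cnorm_sqr -[n%:R]sqr_sqrtr ?(ltW n0) // -exprMn lerXn2r ?nnegrE //.
      by rewrite mulr_ge0 ?sqrtr_ge0.
    exact: ltW.
  rewrite ler_pdivlMr ?ltr0n // mulrC; apply: le_trans h.
  by rewrite ler_wpM2r ?sqnorm_ge0 // ler_nat.
have /choice[f fP] : forall p : nat * nat, exists q : nat,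
    (0 < p.2)%N -> (p.1 <= p.2)%N ->
    [/\ (L <= q)%N, delta p.1 ^+ 2 <= energy (index_iota p.2 (q * p.2)) a &
     energy (index_iota p.2 (q * p.2)) a <= L%:R * delta p.1 ^+ 2].
  move=> [j N] /=.
  have [/andP[N0 jN]|no] := boolP ((0 < N)%N && (j <= N)%N); last first.
    by exists 0%N => h1 h2; move: no; rewrite h1 h2.
  have [q qP] := @block_ratio a N L (delta j) N0 (leq_trans (isT : (2 <= 4)%N) L4)
     (d0 j) (fun n => a_le j N n N0 jN) (div N).
  by exists q.
have [J0 J0P] := exists_nat_ge ((2 * block_cst sc / e) ^+ 2); pose J := J0.+1.
pose Nn := levels (fun j N => f (j, N)) J.
pose rho j := f (j, Nn j).
have Nbig j : (j < Nn j)%N /\ (4 <= rho j)%N.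
  elim: j => [|j [IH1 IH2]].
    by split => //; have [h _ _] := fP (0%N, J) isT isT; exact: leq_trans h.
  have N1 : (j.+1 < Nn j.+1)%N.
    rewrite /Nn /= -/(Nn j) -/(rho j); apply: (@leq_trans (4 * Nn j)%N).
      apply: leq_ltn_trans (IH1) _; rewrite ltn_Pmull //.
      exact: leq_ltn_trans (leq0n j) IH1.
    by rewrite leq_mul2r IH2 orbT.
  split => //; have [h _ _] := fP (j.+1, Nn j.+1) (leq_ltn_trans (leq0n _) N1) (ltnW N1).
  exact: leq_trans h.
have Npos j : (0 < Nn j)%N by have [h _] := Nbig j; exact: leq_ltn_trans h.
have NrhoP j : [/\ (L <= rho j)%N, delta j ^+ 2 <= energy (block Nn j) a &
     energy (block Nn j) a <= L%:R * delta j ^+ 2].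
  by have [h _] := Nbig j; exact: (fP (j, Nn j) (Npos j) (ltnW h)).
have Nrho j : Nn j.+1 = (rho j * Nn j)%N by [].
have rho4 j : (4 <= rho j)%N by have [] := Nbig j.
have N0 : (0 < Nn 0)%N := Npos 0%N.
have sgd j : sigma a Nn j <= kap * delta j.
  have [_ _ h] := NrhoP j; have kd : 0 <= kap * delta j by rewrite mulr_ge0 // ltW.
  rewrite -[leRHS](ger0_norm kd) -sqrtr_sqr ler_wsqrtr //; apply: le_trans h _.
  rewrite exprMn ler_wpM2r ?sqr_ge0 // expr2 ler_peMl // ler1n.
  exact: leq_trans L4.
have sg_ge j : delta j <= sigma a Nn j.
  have [_ h _] := NrhoP j.
  by rewrite -[leLHS](ger0_norm (ltW (d0 j))) -sqrtr_sqr ler_wsqrtr.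
have rS j : r j.+1 = Num.max (r j - c / 4 * delta j) ((C ^+ 2 / c + C) * kap * delta j).
  by [].
have r0 j : 0 <= r j by exact: radius_ge0.
have rv : vanishes r by exact: radius_vanishes.
have a_small j n : (Nn j <= n)%N -> sqnorm (a n) <= delta j ^+ 2 / (Nn j)%:R.
  by apply: a_le => //; have [h _] := Nbig j; exact: ltnW.
have rho_big j : 128 / sc ^+ 2 <= (rho j)%:R.
  have [h _ _] := NrhoP j; apply: le_trans L0P _; rewrite ler_nat.
  by apply: leq_trans h; exact: leq_addr.
pose F := fails a Nn rho A r C; exists F, Nn; split.
- exact: Npos.
- by move=> m s; rewrite /F failsS => ->.
- move=> m s s' ss'; apply: eq_fails => // n /andP[h1 h2]; apply: ss'.
  by rewrite h2 andbT; exact: leq_trans h1.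
- move=> m s.
  have := @expect_fails R a Nn rho A delta r c C kap N0 Nrho rho4 A32 d0 d2 sgd C0 kap0
     r0 c0 Ac sg_ge rS sc sc0 sc1 scK cE CE a_small rho_big m s.
  move=> h; apply: le_trans h _.
  have K0 := block_cst_ge0 sc0.
  apply: (@le_trans _ _ (block_cst sc * Num.sqrt (A%:R / (grid Nn A 0)%:R) * 2)).
    by apply: ler_wpM2l (sum_half _ m); rewrite mulr_ge0 ?sqrtr_ge0.
  have Jp : 0 < J%:R :> R by rewrite ltr0n.
  have Ap : 0 < A%:R :> R by rewrite ltr0n (leq_trans _ A32).
  have -> : A%:R / (grid Nn A 0)%:R = J%:R^-1 :> R.
    by rewrite /grid natrM; field; rewrite !gt_eqF.
  have sJ : 0 < Num.sqrt (J%:R : R) by rewrite sqrtr_gt0.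
  have key : 2 * block_cst sc / e <= Num.sqrt J%:R.
    have k0 : 0 <= 2 * block_cst sc / e by rewrite divr_ge0 ?(ltW e0) // mulr_ge0.
    rewrite -(ger0_norm k0) -sqrtr_sqr ler_wsqrtr //; apply: le_trans J0P _.
    by rewrite ler_nat.
  rewrite ler_pdivrMr // in key.
  rewrite sqrtrV ?(ltW Jp) // mulrAC ler_pdivrMr //.
  by rewrite [_ * 2]mulrC [e * _]mulrC.
- move=> s nF.
  have al j : exists k, (k < grid Nn A j)%N && alive a Nn rho A r C j k s.
    apply: survivors_alive; apply: lt_le_trans (survivors_ge (nF j)) => //.
    rewrite mulr_gt0 ?exprn_gt0 // ltr0n muln_gt0 N0 andbT.
    exact: leq_trans A32.
  have [t tP] := alive_cvg N0 Nrho rho4 A32 d0 d2 sgd C0 kap0 dv rv r0 al.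
  exists t => x x0; have x2 : 0 < x / 2 by rewrite divr_gt0.
  have [M0 MP] := tP _ x2; exists (maxn M0 (Nn 0%N)) => M MM.
  set M1 := maxn _ _ in MM *.
  have M01 : (M0 <= M1)%N by exact: leq_maxl.
  have NM1 : (Nn 0 <= M1 <= M)%N by rewrite leq_maxr.
  have -> : tsum a M1 M t s = tsum a (Nn 0%N) M t s - tsum a (Nn 0%N) M1 t s.
    by rewrite (tsum_cat _ _ _ NM1) addrC addKr.
  apply: le_trans (cnormB _ _) _.
  by have := MP _ M01; have := MP _ (leq_trans M01 MM); lra.
Qed.

Lemma tail_energy a (B : R) : (forall M, energy (index_iota 1 M) a <= B) ->
  forall e : R, 0 < e ->
  exists2 N, (0 < N)%N & forall M, (N <= M)%N -> energy (index_iota N M) a <= e.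
Proof.
move=> aB e e0.
pose X := [set energy (index_iota 1 M) a | M in [set: nat]].
have supX : has_sup X.
  split; first by exists (energy (index_iota 1 0) a), 0%N.
  by exists B => _ [M _ <-].
have [_ [N _ <-] Ne] := sup_adherent e0 supX.
have grow M M' : (0 < M)%N -> (M <= M')%N -> energy (index_iota 1 M') a =
    energy (index_iota 1 M) a + energy (index_iota M M') a.
  by move=> M0 MM'; rewrite /energy [LHS](big_cat_nat M0 MM').
have [N0|N0] := posnP N.
  exists 1%N => // M _; have Ms : energy (index_iota 1 M) a <= sup X.
    by apply: sup_upper_bound => //; exists M.
  by move: Ne; rewrite N0 energy_nil; lra.
exists N => // M NM; have Ms : energy (index_iota 1 M) a <= sup X.
  by apply: sup_upper_bound => //; exists M.
by move: Ms Ne; rewrite (grow N M) //; lra.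
Qed.

Lemma convergent_case a (B : R) : (forall M, energy (index_iota 1 M) a <= B) ->
  forall x : R, 0 < x -> small_failure (fun s => exists M0, forall M, (M0 <= M)%N ->
     cnorm (tsum a M0 M 0 s) <= x).
Proof.
move=> aB x x0 e e0.
have x2 : 0 < x ^+ 2 by rewrite exprn_gt0.
have [N N0 NM] := tail_energy aB (mulr_gt0 e0 x2).
pose F m s := has (fun i => x ^+ 2 <= sqnorm (tsum a N (N + i) 0 s)) (iota 0 m.+1).
exists F, (fun m => N + m)%N; split.
- by move=> m; rewrite addn_gt0 N0.
- by move=> m s Fm; rewrite /F -[m.+2]addn1 iotaD has_cat; apply/orP; left.
- move=> m s s' ss'; apply: eq_in_has => i; rewrite mem_iota add0n ltnS => im.
  rewrite (@eq_tsum _ _ _ _ _ s s') // => n /andP[Nn nN]; apply: ss'.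
  by rewrite (leq_trans N0) // (leq_trans nN) // leq_add2l.
- move=> m s; pose l := index_iota N (N + m).
  have sl : size l = m by rewrite size_iota addKn.
  have -> : index_iota 1 (N + m) = index_iota 1 N ++ l.
    rewrite /l /index_iota -[X in _ ++ iota X _](subnKC N0) -iotaD.
    by congr iota; rewrite addKn addnBAC.
  rewrite expect_cat -[leRHS](expect_cst (index_iota 1 N) e s); apply: expect_le => s'.
  pose b n := a n * cis (n%:R * 0).
  have bE : energy l b = energy l a.
    by apply: eq_bigr => n _; rewrite /b sqnormM sqnorm_cis mulr1.
  have := @kolmogorov R l b 0 (x ^+ 2) s' (iota_uniq _ _) x2.
  rewrite sqnorm0 add0r bE sl => h; apply: le_trans (le_trans h _).
    rewrite le_eqVlt; apply/orP; left; apply/eqP; apply: expect_eq => s''; congr (_%:R).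
    congr nat_of_bool; apply: eq_in_has => i; rewrite mem_iota add0n ltnS => im.
    rewrite add0r tsum_walk /l /index_iota take_iota !addKn (minn_idPl im) //.
  by rewrite ler_pdivrMr // NM // leq_addr.
- move=> s nF; exists N => M NM'; apply: cnorm_le (ltW x0) _; apply: ltW.
  rewrite ltNge; apply/negP => h; have := nF (M - N)%N; rewrite /F => /hasPn/(_ (M - N)%N).
  by rewrite mem_iota add0n ltnSn subnKC // h => /(_ isT).
Qed.

End Scales.

(** * From averages over signs to the probability space *)

Section Transfer.
Context (R : realType) (d : measure_display) (T : measurableType d).
Context (P : probability T R) (eps : nat -> {RV P >-> R}).
Hypothesis indep : mutually_independent [set n : nat | (0 < n)%N] eps.
Hypothesis unif : forall n : nat, (0 < n)%N -> uniform_sign (eps n).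
Implicit Types (s : nat -> bool) (F : (nat -> bool) -> bool).

(** A sign is read as the event that it equals 1, so that no exceptional null set
enters the distribution of the bits. *)
Definition bits (w : T) : nat -> bool := fun n => eps n w == 1.

Definition side (b : bool) : set R := if b then [set 1] else ~` [set 1].

Lemma measurable_side b : measurable (side b).
Proof. by case: b => /=; [|apply: measurableC]; exact: measurable_set1. Qed.

Lemma side_bits n b w : side b (eps n w) <-> bits w n = b.
Proof.
rewrite /bits; case: b => /=; first by split => [->|/eqP//]; rewrite eqxx.
by split => [ne|/eqP//]; apply/eqP.
Qed.

Lemma bits_side n b : [set w | bits w n = b] = eps n @^-1` side b.
Proof. by apply/seteqP; split => w /=; rewrite side_bits. Qed.

Lemma measurable_bit n b : measurable [set w | bits w n = b].
Proof. by rewrite bits_side; apply: measurable_funPTI; exact: measurable_side. Qed.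

Lemma prob_side n b : (0 < n)%N -> P (eps n @^-1` side b) = (2^-1 : R)%:E.
Proof.
move=> /unif[h1 _]; case: b => //=; rewrite -preimage_setC probability_setC.
  by rewrite h1 -EFinB; congr (_%:E); lra.
by apply: measurable_funPTI; exact: measurable_set1.
Qed.

Definition cylinder s k : set T := [set w | forall n, (0 < n < k)%N -> bits w n = s n].

Lemma cylinder_bigcap s k : cylinder s k =
  \bigcap_(i in [set` [fset n in index_iota 1 k]%fset]) (eps i @^-1` side (s i)).
Proof.
apply/seteqP; split => w /= h n /=.
  by rewrite !inE mem_index_iota => /h nk; apply/side_bits.
move=> nk; have := h n; rewrite /= !inE mem_index_iota => /(_ nk).
by move/side_bits.
Qed.

Lemma measurable_cylinder s k : measurable (cylinder s k).
Proof.
rewrite cylinder_bigcap; apply: fin_bigcap_measurable; first exact: finite_fset.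
by move=> i _; rewrite -bits_side; exact: measurable_bit.
Qed.

Lemma prob_cylinder s k : P (cylinder s k) = (2^-1 ^+ k.-1 : R)%:E.
Proof.
rewrite cylinder_bigcap indep; last by move=> i; exact: measurable_side.
  rewrite (eq_big_seq (fun=> (2^-1 : R)%:E)); last first.
    move=> n; rewrite !inE mem_index_iota => /andP[n0 _]; exact: prob_side.
  rewrite prodEFin big_const_seq count_predT iter_mulr_1; congr ((_ ^+ _)%:E).
  by rewrite card_fseq undup_id ?iota_uniq // size_iota subn1.
by move=> i /=; rewrite !inE mem_index_iota => /andP[].
Qed.

(** Splitting a cylinder along its next bit mirrors the recursion that defines
[expect]. *)
Lemma prob_bits_from F D k s : (0 < k)%N ->
  (forall s s', (forall n, (0 < n < k + D)%N -> s n = s' n) -> F s = F s') ->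
  measurable (cylinder s k `&` [set w | F (bits w)]) /\
  P (cylinder s k `&` [set w | F (bits w)]) =
    (2^-1 ^+ k.-1 * expect (iota k D) (fun s => (F s)%:R) s)%:E.
Proof.
elim: D k s => [|D IH] k s k0 FD.
  have E : cylinder s k `&` [set w | F (bits w)] = if F s then cylinder s k else set0.
    apply/seteqP; split => w /=.
      move=> [ws Fw]; rewrite -(FD (bits w) s) ?Fw // => n nk; apply: ws.
      by rewrite addn0 in nk.
    case: ifP => // Fs ws; split => //; rewrite (FD _ s) // => n; rewrite addn0.
    exact: ws.
  rewrite E /=; case: ifP => _.
    by rewrite prob_cylinder mulr1; split => //; exact: measurable_cylinder.
  by rewrite measure0 mulr0; split => //; exact: measurable0.
have FD' s1 s2 : (forall n, (0 < n < k.+1 + D)%N -> s1 n = s2 n) -> F s1 = F s2.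
  by rewrite addSnnS; exact: FD.
have [m1 p1] := IH k.+1 (upd s k true) isT FD'.
have [m2 p2] := IH k.+1 (upd s k false) isT FD'.
have split_cyl : cylinder s k `&` [set w | F (bits w)] =
    (cylinder (upd s k true) k.+1 `&` [set w | F (bits w)]) `|`
    (cylinder (upd s k false) k.+1 `&` [set w | F (bits w)]).
  rewrite -setIUl; congr (_ `&` _); apply/seteqP; split => w /=.
    move=> ws; have [e|e] : bits w k = true \/ bits w k = false by case: (bits w k); [left|right].
      left => n /andP[n0]; rewrite ltnS leq_eqVlt => /orP[/eqP->|nk]; first by rewrite upd_same.
      by rewrite upd_other ?ltn_eqF // ws // n0.
    right => n /andP[n0]; rewrite ltnS leq_eqVlt => /orP[/eqP->|nk]; first by rewrite upd_same.
    by rewrite upd_other ?ltn_eqF // ws // n0.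
  move=> [|] ws n /andP[n0 nk]; have := ws n; rewrite n0 ltnS (ltnW nk) upd_other;
    by [apply|rewrite ltn_eqF].
rewrite split_cyl; split; first exact: measurableU.
transitivity (P (cylinder (upd s k true) k.+1 `&` [set w | F (bits w)]) +
  P (cylinder (upd s k false) k.+1 `&` [set w | F (bits w)]))%E.
  apply: measureU => //; apply/seteqP; split => // w /= [[h1 _] [h2 _]].
  by have := h1 k; have := h2 k; rewrite k0 ltnSn !upd_same => -> // /(_ isT).
rewrite p1 p2 -EFinD; congr (_%:E); rewrite expect_cons -(prednK k0) /= exprS.
by field.
Qed.

Lemma prob_bits F D : (0 < D)%N ->
  (forall s s', (forall n, (0 < n < D)%N -> s n = s' n) -> F s = F s') ->
  measurable [set w | F (bits w)] /\
  P [set w | F (bits w)] = (expect (index_iota 1 D) (fun s => (F s)%:R) (fun=> true))%:E.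
Proof.
move=> D0 FD; have := @prob_bits_from F D.-1 1 (fun=> true) isT.
rewrite add1n prednK // => /(_ FD).
have -> : cylinder (fun=> true) 1 = setT.
  by apply/seteqP; split => // w _ [|n].
by rewrite setTI expr0 mul1r /index_iota subn1.
Qed.

Lemma small_failure_ae (Q : (nat -> bool) -> Prop) : small_failure R Q ->
  {ae P, forall w, Q (bits w)}.
Proof.
move=> Qsf.
have cover (i : nat) : exists B, [/\ measurable B, (P B <= (i.+1%:R^-1)%:E)%E &
    [set w | ~ Q (bits w)] `<=` B].
  have e0 : 0 < i.+1%:R^-1 :> R by rewrite invr_gt0.
  have [F [D [D0 Fmono FD FE FQ]]] := Qsf _ e0.
  pose A m := [set w | F m (bits w)].
  have mA m : measurable (A m) by have [] := prob_bits (D0 m) (FD m).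
  have PA m : (P (A m) <= (i.+1%:R^-1)%:E)%E.
    by have [_ ->] := prob_bits (D0 m) (FD m); rewrite lee_fin.
  exists (\bigcup_m A m); split.
  - exact: bigcup_measurable.
  - have Acvg := @nondecreasing_cvg_mu _ _ _ P A mA (bigcup_measurable (fun m _ => mA m)).
    have Amono : {homo A : n m / (n <= m)%N >-> (n <= m)%O}.
      move=> n m cnorm; apply/subsetPset => w; rewrite /A /= -(subnKC cnorm).
      elim: (m - n)%N => [|k IH]; first by rewrite addn0.
      by move=> /IH; rewrite addnS; exact: Fmono.
    have {}Acvg := Acvg Amono.
    rewrite -(cvg_lim _ Acvg) //; apply: lime_le; first by apply/cvg_ex; eexists; exact: Acvg.
    by near=> m; exact: PA.
  - move=> w nQ; apply: contrapT => nA; apply: nQ; apply: FQ => m.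
    by apply/negP => Fm; apply: nA; exists m.
have [B BP] := choice cover.
exists (\bigcap_i B i); split.
- by apply: bigcap_measurable => // i _; have [] := BP i.
- apply/eqP; rewrite eq_le measure_ge0 andbT; apply/lee_addgt0Pr => e e0; rewrite add0e.
  have [N Ne] := vanishes_inv e0.
  have [mB PB _] := BP N.
  apply: (@le_trans _ _ (P (B N))).
    apply: le_measure; rewrite ?inE //; last by move=> w; exact.
    by apply: bigcap_measurable => // i _; have [] := BP i.
  by apply: le_trans PB _; rewrite lee_fin Ne.
- by move=> w /= nQ i _; have [_ _] := BP i; exact.
Unshelve. all: by end_near. Qed.

Lemma eps_rad_ae : {ae P, forall w, forall n, (0 < n)%N -> eps n w = rad R (bits w n)}.
Proof.
apply: ae_foralln => n; have [->|n0] := posnP n.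
  by apply: filterE.
have [h1 h2] := unif n0.
have neq : ((1 : R) == -1) = false by apply/gt_eqF; lra.
pose A := eps n @^-1` [set 1]; pose B := eps n @^-1` [set -1].
have mA : measurable A by apply: measurable_funPTI; exact: measurable_set1.
have mB : measurable B by apply: measurable_funPTI; exact: measurable_set1.
have AB : A `&` B = set0.
  by apply/seteqP; split => // w [] /=; rewrite /A /B /= => -> /eqP; rewrite neq.
exists (~` (A `|` B)); split.
- by apply: measurableC; exact: measurableU.
- have h := probability_setC P (measurableU _ _ mA mB).
  apply: (etrans h); have -> : P (A `|` B) = (P A + P B)%E by exact: measureU.
  by rewrite /A /B h1 h2 -!EFinD; congr (_%:E); lra.
- move=> w /= nr [] e; apply: nr => _; rewrite /bits; move: e; rewrite /A /B /= => ->.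
    by rewrite eqxx.
  by rewrite eq_sym neq.
Qed.

End Transfer.

(** * Cauchy sequences of complex numbers *)

Section Convergence.
Variable R : realType.

Lemma cnorm_le_ReIm (x : R[i]) : cnorm x <= `|complex.Re x| + `|complex.Im x|.
Proof.
apply: cnorm_le; first by rewrite addr_ge0.
rewrite /sqnorm -(real_normK (num_real (complex.Re x))) -(real_normK (num_real (complex.Im x))).
by have := mulr_ge0 (normr_ge0 (complex.Re x)) (normr_ge0 (complex.Im x)); lra.
Qed.

Lemma norm_Re_le (x : R[i]) : `|complex.Re x| <= cnorm x.
Proof. by apply: norm_le_sqr (cnorm_ge0 _) _; rewrite cnorm_sqr sqr_Re_le. Qed.

Lemma norm_Im_le (x : R[i]) : `|complex.Im x| <= cnorm x.
Proof. by apply: norm_le_sqr (cnorm_ge0 _) _; rewrite cnorm_sqr lerDr sqr_ge0. Qed.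

Lemma cauchy_cvgn_real (v : nat -> R) :
  (forall e : R, 0 < e -> exists M0, forall M, (M0 <= M)%N -> `|v M - v M0| <= e) ->
  exists l : R, forall e : R, 0 < e -> exists M0, forall M, (M0 <= M)%N -> `|l - v M| <= e.
Proof.
move=> vC.
have /cvg_ex[l vl] : cvgn v.
  apply: cauchy_cvg; apply: cauchy_exP => e e0.
  have [M0 h] := vC _ (divr_gt0 e0 (ltr0n R 2)); exists (v M0).
  exists M0 => // M /= /h; rewrite /ball /= distrC => h'.
  by apply: le_lt_trans h' _; lra.
exists l => e e0; move/cvgrPdist_le : vl => /(_ e e0)[M0 _ h].
by exists M0 => M; exact: h.
Qed.

Lemma cauchy_cvgn_complex (v : nat -> R[i]) :
  (forall e : R, 0 < e -> exists M0, forall M, (M0 <= M)%N -> cnorm (v M - v M0) <= e) ->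
  cvgn v.
Proof.
move=> vC.
have [x xP] : exists x : R, forall e : R, 0 < e -> exists M0, forall M, (M0 <= M)%N ->
    `|x - complex.Re (v M)| <= e.
  apply: cauchy_cvgn_real => e /vC[M0 h]; exists M0 => M /h; apply: le_trans.
  apply: le_trans (norm_Re_le _); rewrite le_eqVlt; apply/orP; left; apply/eqP.
  by case: (v M) (v M0) => ? ? [].
have [y yP] : exists y : R, forall e : R, 0 < e -> exists M0, forall M, (M0 <= M)%N ->
    `|y - complex.Im (v M)| <= e.
  apply: cauchy_cvgn_real => e /vC[M0 h]; exists M0 => M /h; apply: le_trans.
  apply: le_trans (norm_Im_le _); rewrite le_eqVlt; apply/orP; left; apply/eqP.
  by case: (v M) (v M0) => ? ? [].
apply/cvg_ex; exists (x +i* y); apply/cvgrPdist_le => e e0.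
have e0' : 0 < complex.Re e by move: e0; rewrite ltcE /= => /andP[].
have eE : e = (complex.Re e)%:C.
  by case: (e) e0 => e1 e2; rewrite ltcE /= => /andP[/eqP -> _].
have [M1 h1] := xP _ (divr_gt0 e0' (ltr0n R 2)).
have [M2 h2] := yP _ (divr_gt0 e0' (ltr0n R 2)).
exists (maxn M1 M2) => // M /=; rewrite geq_max => /andP[/h1 g1 /h2 g2].
rewrite eE normC_cnorm lecR; apply: le_trans (cnorm_le_ReIm _) _.
by case: (v M) g1 g2 => p q /= g1 g2; lra.
Qed.

End Convergence.

Theorem theorem1p1 (R : realType) (d : measure_display)
    (T : measurableType d) (P : probability T R)
    (a : nat -> R[i]) (eps : nat -> {RV P >-> R}) :
  (Num.sqrt n%:R)%:C * `|a n| @[n --> \oo] --> (0 : R[i]) ->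
  mutually_independent [set n : nat | (0 < n)%N] eps ->
  (forall n : nat, (0 < n)%N -> uniform_sign (eps n)) ->
  {ae P, forall w : T, exists z : R[i],
    `|z| = 1 /\
    cvgn (fun N : nat => \sum_(1 <= n < N.+1) (eps n w)%:C * a n * z ^+ n)}.
Proof.
move=> a0 indep unif.
have av : vanishes (fun n => Num.sqrt n%:R * cnorm (a n)).
  move=> e e0; have e0' : 0 < e%:C :> R[i] by rewrite ltcR.
  move/cvgrPdist_le: a0 => /(_ _ e0')[M _ h]; exists M => j /h /=.
  rewrite sub0r normrN normrM normC_cnorm normr_id normC_cnorm -rmorphM lecR.
  by rewrite /cnorm {1}/sqnorm /= expr0n addr0 sqrtr_sqr ger0_norm // sqrtr_ge0.
have somewhere : {ae P, forall w, converges_somewhere a (bits eps w)}.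
  have [div|ndiv] := pselect (forall N B, exists N', B <= energy (index_iota N N') a).
    by have := small_failure_ae indep unif (divergent_case av div).
  have [B aB] : exists B : R, forall M, energy (index_iota 1 M) a <= B.
    have /existsNP[N /existsNP[B nB]] := ndiv.
    have NB N' : energy (index_iota N N') a <= B.
      by rewrite leNgt; apply/negP => /ltW lt; apply: nB; exists N'.
    exists (energy (index_iota 0 N) a + B) => M; pose M' := maxn M N.
    have NM' : (N <= M')%N by exact: leq_maxr.
    apply: (@le_trans _ _ (energy (index_iota 0 M') a)).
      by apply: energy_iota_le => //; exact: leq_maxl.
    by rewrite /energy (big_cat_nat (leq0n N) NM') /= lerD2l; exact: NB.
  have aei (i : nat) : {ae P, forall w, exists M0, forall M, (M0 <= M)%N ->
      cnorm (tsum a M0 M 0 (bits eps w)) <= i.+1%:R^-1}.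
    have i0 : 0 < i.+1%:R^-1 :> R by rewrite invr_gt0.
    by have := small_failure_ae indep unif (convergent_case aB i0).
  have := ae_foralln aei; apply: filterS => w wP; exists 0 => e e0.
  have [N Ne] := vanishes_inv e0; have [M0 h] := wP N; exists M0 => M /h.
  by move=> h'; apply: le_trans h' (Ne N (leqnn N)).
have rade := eps_rad_ae unif.
apply: (filterS2 _ _ somewhere rade) => w [t tP] wr; exists (cis t).
split; first by rewrite normC_cnorm cnorm_cis.
have E N : (0 < N)%N -> \sum_(1 <= n < N) (eps n w)%:C * a n * cis t ^+ n = tsum a 1 N t (bits eps w).
  move=> N0; apply: eq_big_nat => n /andP[n0 _].
  by rewrite wr // cisX mulrA.
apply: cauchy_cvgn_complex => e e0.
have [M0 h] := tP _ (divr_gt0 e0 (ltr0n R 2)); exists M0 => M MM; rewrite !E //.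
have N1 : (1 <= M0.+1 <= M.+1)%N by [].
have N2 : (M0 <= M0.+1 <= M.+1)%N by rewrite leqnSn.
have E2 := tsum_cat a t (bits eps w) N2.
rewrite (tsum_cat a t _ N1) [X in cnorm X]addrC addKr.
have -> : tsum a M0.+1 M.+1 t (bits eps w) =
    tsum a M0 M.+1 t (bits eps w) - tsum a M0 M0.+1 t (bits eps w).
  by rewrite E2 addrC addKr.
apply: le_trans (cnormB _ _) _.
by have := h _ (leqnSn M0); have := h _ (leqW MM); lra.
Qed.
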